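(* Let $0<p<1$. Let $B$ be a Blaschke product whose sequence of zeros $\{a_n\}_{n\ge1}$ is uniformly discrete. If $B' \in H^p$, then $$\sum_{n} (1-|a_n|)^{1-p} < \infty.$$
   Context: $U$ denotes the open unit disc in $\mathbb{C}$. If $\{a_n\}_{n\ge1}$ is a sequence of complex numbers with $0<|a_n|<1$ for all $n$ and $\sum_{n=1}^\infty (1-|a_n|)<\infty$, the Blaschke product with zeros $\{a_n\}$ is the analytic function on $U$ given by $$B(z) = \prod_{n=1}^{\infty} \frac{\bar a_n}{|a_n|}\,\frac{a_n - z}{1-\bar a_n z}.$$ A sequence $\{a_n\}$ in $U$ is uniformly discrete (or separated) if there is a constant $\delta>0$ such that $\rho(a_m,a_n)\ge\delta$ for all $m\neq n$, where $\rho(z,w)=\left|\frac{z-w}{1-\bar w z}\right|$ for $z,w\in U$ is the pseudohyperbolic metric. For $0<p<\infty$, the Hardy space $H^p$ is the set of functions $f$ analytic in $U$ with $$\sup_{0<r<1}\left\{\frac1{2\pi}\int_0^{2\pi}|f(re^{it})|^p\,dt\right\}^{1/p}<\infty.$$ *)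

(* Defs.v *)
From HB Require Import structures.
From mathcomp Require Import all_boot all_order all_algebra complex.
From mathcomp Require Import all_classical all_reals all_analysis.
Set Implicit Arguments.
Unset Strict Implicit.
Unset Printing Implicit Defensive.
Import Order.TTheory GRing.Theory Num.Theory numFieldNormedType.Exports.
Local Open Scope classical_set_scope.
Local Open Scope ring_scope.
Local Open Scope complex_scope.

(* The topology and the normed-module structure of the complex numbers are
   those of [R[i]^o], so limits and derivatives are taken over the field
   [R[i]].  The norm [`|z|] of that structure lives in [R[i]]; [cmod] is the
   modulus as an element of [R]. *)
Definition cmod {R : realType} (z : R[i]) : R := ComplexField.Normc.normc z.

Definition unit_disc {R : realType} : set R[i] := [set z | cmod z < 1].

(* For a map between [R[i]^o] and [R[i]^o], derivability along [1] is complex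
   differentiability. *)
Definition analytic_on {R : realType} (D : set R[i]) (f : R[i]^o -> R[i]^o) :=
  forall z, D z -> derivable f z 1.

Definition pseudohyp {R : realType} (z w : R[i]) : R :=
  cmod ((z - w) / (1 - w^* * z)).

Definition uniformly_discrete {R : realType} (a : nat -> R[i]) :=
  exists2 delta : R, 0 < delta &
    forall m n : nat, m <> n -> delta <= pseudohyp (a m) (a n).

(* Sequences are indexed from [0]. *)
Definition blaschke_sequence {R : realType} (a : nat -> R[i]) :=
  (forall n, 0 < cmod (a n) < 1) /\
  (\sum_(0 <= n <oo) (1 - cmod (a n))%:E < +oo)%E.

Definition blaschke_factor {R : realType} (a z : R[i]) : R[i] :=
  a^* / (cmod a)%:C * ((a - z) / (1 - a^* * z)).

Definition blaschke_product {R : realType} (a : nat -> R[i]) :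
    R[i]^o -> R[i]^o :=
  fun z => lim ((\prod_(0 <= k < n) blaschke_factor (a k) z : R[i]^o)
                  @[n --> \oo]).

Definition integral_mean {R : realType} (p : R) (f : R[i]^o -> R[i]^o)
    (r : R) : \bar R :=
  (((2 * pi)^-1%:E *
    \int[lebesgue_measure]_(t in `[0%R, (2 * pi)%R])
      (cmod (f (r%:C * (cos t +i* sin t))) `^ p)%:E) `^ p^-1)%E.

Definition hardy {R : realType} (p : R) (f : R[i]^o -> R[i]^o) :=
  analytic_on unit_disc f /\
  (ereal_sup [set integral_mean p f r | r in `]0%R, 1%R[] < +oo)%E.

(* Main.v *)
Require Import Defs.
From mathcomp Require Import all_boot all_order all_algebra complex.
From mathcomp Require Import all_classical all_reals all_analysis.
From mathcomp Require Import measurable_realfun ring lra.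

(** Write w = 1 - |B|^2 and x_n = 1 - |a_n|. The proof stays inside the disc: it
    uses neither boundary values of B nor a maximal theorem.

    The basic inequality is Schwarz-Pick, |B'(z)| (1 - |z|^2) <= w(z), proved for
    finite products by induction ([schwarz_pick_bprod]) and passed to the limit.
    The same passage to the limit, with a Taylor bound that is uniform in the
    number of factors, shows that B is differentiable
    ([blaschke_taylor_dbprod]). Schwarz-Pick is used along radii in two ways.

    First, the ratio w(r e^{it}) (1 + r) / (1 - r) is nondecreasing in r
    ([defect_growth]).

    Second, since p < 1, it gives w^(p-1) |B'| <= |B'|^p (1 - r)^(p-1), so the
    radial derivative of w^p is at most 2 p |B'|^p (1 - r)^(p-1) in absolute value
    ([defect_powR_derivative_le]). Integrate this from r to s and then over the
    circle. The means of |B'|^p are bounded by hypothesis, and the boundary term,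
    the mean of w^p at radius s, tends to 0 as s tends to 1: by the Poisson
    integral of one factor ([integral_factor_defect]) the means of w do
    ([mean_defect_le]). The result is
      int w(r e^{it})^p dt <= C (1 - r)^p   ([mean_defect_powR_decay]).

    To count zeros, let J_n be an arc of length c x_n under a_n. For t in J_n the
    point |a_n| e^{it} is close to the zero a_n, so w >= 3/4 there, and
    by monotonicity x_n >= h(t) := (3/8) (1 - r) / w(r e^{it}) for every r between
    |a_n| and 1. The zeros whose arcs contain a given t have almost the same
    argument, so uniform discreteness makes their x_n grow geometrically; hence
    the sum of x_n^(-p) over them is at most a constant times h(t)^(-p)
    ([separated_sum_powRN], [near_zero_sum_le]). Integrating over t bounds the
    partial sums of c x_n^(1-p) by a constant times (1 - r)^(-p) int w^p dt, which
    is bounded by the decay estimate ([partial_sum_le]). *)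

Set Implicit Arguments.
Unset Strict Implicit.
Unset Printing Implicit Defensive.
Import Order.TTheory GRing.Theory Num.Theory numFieldNormedType.Exports.
Local Open Scope classical_set_scope.
Local Open Scope ring_scope.
Local Open Scope complex_scope.

Local Notation "x ^*" := (Num.conj x) : complex_scope.

(** * The modulus and Blaschke factors *)

Section Modulus.
Context {R : realType}.
Implicit Types z w : R[i].

Lemma cmodM z w : cmod (z * w) = cmod z * cmod w.
Proof. exact: ComplexField.Normc.normcM. Qed.

Lemma cmodV z : cmod z^-1 = (cmod z)^-1.
Proof. exact: ComplexField.Normc.normcV. Qed.

Lemma cmodN z : cmod (- z) = cmod z.
Proof. exact: normcN. Qed.

Lemma cmodB z w : cmod (z - w) = cmod (w - z).
Proof. by rewrite -cmodN opprB. Qed.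

Lemma cmod0 : cmod (0 : R[i]) = 0.
Proof. exact: ComplexField.Normc.normc0. Qed.

Lemma cmod1 : cmod (1 : R[i]) = 1.
Proof. exact: ComplexField.Normc.normc1. Qed.

Lemma cmodX z n : cmod (z ^+ n) = cmod z ^+ n.
Proof. by elim: n => [|n IH]; rewrite ?expr0 ?cmod1// !exprS cmodM IH. Qed.

Lemma ler_cmodD z w : cmod (z + w) <= cmod z + cmod w.
Proof. exact: le_normcD. Qed.

Lemma ler_cmodB z w : cmod (z - w) <= cmod z + cmod w.
Proof. by rewrite -(cmodN w) ler_cmodD. Qed.

Lemma lerB_cmod z w : cmod z - cmod w <= cmod (z - w).
Proof. by rewrite lerBlDr -{1}(subrK w z) ler_cmodD. Qed.

Lemma cmod_ge0 z : 0 <= cmod z.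
Proof. by case: z => x y; exact: sqrtr_ge0. Qed.

Lemma cmod_sq z : cmod z ^+ 2 = complex.Re z ^+ 2 + complex.Im z ^+ 2.
Proof. by case: z => x y /=; rewrite /cmod /= sqr_sqrtr// addr_ge0 ?sqr_ge0. Qed.

Lemma cmodC (x : R) : cmod x%:C = `|x|.
Proof. by rewrite /cmod /= expr0n /= addr0 sqrtr_sqr. Qed.

Lemma cmod_conj z : cmod z^* = cmod z.
Proof. by case: z => x y; rewrite /cmod /= sqrrN. Qed.

Lemma cmod_eq0 z : cmod z = 0 -> z = 0.
Proof. exact: ComplexField.Normc.eq0_normc. Qed.

Lemma cmod_gt0 z : (0 < cmod z) = (z != 0).
Proof.
rewrite lt_def cmod_ge0 andbT; congr (~~ _); apply/eqP/eqP => [/cmod_eq0//|->].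
exact: cmod0.
Qed.

Lemma normc_cmod (z : R[i]^o) : `|z| = (cmod z)%:C.
Proof. by []. Qed.

Lemma ler_Re_cmod z : `|complex.Re z| <= cmod z.
Proof.
rewrite -(@ler_pXn2r _ 2) ?nnegrE ?cmod_ge0// cmod_sq real_normK ?num_real//.
by rewrite lerDl sqr_ge0.
Qed.

Lemma ler_Im_cmod z : `|complex.Im z| <= cmod z.
Proof.
rewrite -(@ler_pXn2r _ 2) ?nnegrE ?cmod_ge0// cmod_sq real_normK ?num_real//.
by rewrite lerDr sqr_ge0.
Qed.

Lemma ler_cmod_ReIm z : cmod z <= `|complex.Re z| + `|complex.Im z|.
Proof.
rewrite -(@ler_pXn2r _ 2) ?nnegrE ?cmod_ge0 ?addr_ge0// cmod_sq.
rewrite sqrrD !real_normK ?num_real// lerD2r lerDl mulrn_wge0//.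
Qed.

(** Dividing by the denominator gives the identity for 1 - |b|^2 behind both
    the contractivity of a Blaschke factor and its means over circles. *)
Lemma cmod_moebius_num (a z : R[i]) :
  cmod (a - z) ^+ 2 =
  cmod (1 - a^* * z) ^+ 2 - (1 - cmod a ^+ 2) * (1 - cmod z ^+ 2).
Proof. rewrite !cmod_sq; case: a z => [x y] [u v] /=; ring. Qed.

Lemma ler_moebius_den (a z : R[i]) : cmod a <= 1 ->
  1 - cmod z <= cmod (1 - a^* * z).
Proof.
move=> ha; apply: le_trans (lerB_cmod _ _); rewrite cmod1 lerD2l lerN2 cmodM.
by rewrite cmod_conj ler_piMl ?cmod_ge0.
Qed.

Lemma ler_moebius_den2 (a z : R[i]) : cmod z <= 1 ->
  1 - cmod a <= cmod (1 - a^* * z).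
Proof.
move=> hz; apply: le_trans (lerB_cmod _ _); rewrite cmod1 lerD2l lerN2 cmodM.
by rewrite cmod_conj ler_piMr ?cmod_ge0.
Qed.

End Modulus.

Arguments cmod : simpl never.

Section Factor.
Context {R : realType} (a : R[i]) (ha : 0 < cmod a < 1).
Implicit Types z h : R[i].
Local Notation b := (blaschke_factor a).
Local Notation x := (1 - cmod a).

(** The derivative in [z] of the Blaschke factor with zero [a]. *)
Definition dblaschke_factor (a z : R[i]) : R[i] :=
  - (a^* / (cmod a)%:C * ((1 - (cmod a)%:C ^+ 2) / (1 - a^* * z) ^+ 2)).
Local Notation db := (dblaschke_factor a).

Let a_gt0 : 0 < cmod a. Proof. by case/andP: ha. Qed.
Let a_lt1 : cmod a < 1. Proof. by case/andP: ha. Qed.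

Lemma moebius_den_neq0 z : cmod z < 1 -> 1 - a^* * z != 0.
Proof.
move=> hz; rewrite -cmod_gt0; apply: lt_le_trans (ler_moebius_den _ (ltW a_lt1)).
by rewrite subr_gt0.
Qed.

Lemma conj_mulC : a^* * a = (cmod a)%:C ^+ 2.
Proof.
rewrite -rmorphXn /= cmod_sq; case: a => u v; apply/eqP.
by rewrite eq_complex /=; apply/andP; split; apply/eqP; ring.
Qed.

Let ca_neq0 : (cmod a)%:C != 0.
Proof. by rewrite -cmod_gt0 cmodC gtr0_norm. Qed.


Lemma cmod_unimod : cmod (a^* / (cmod a)%:C) = 1.
Proof.
by rewrite cmodM cmodV cmodC cmod_conj ger0_norm ?divff ?lt0r_neq0// cmod_ge0.
Qed.

Lemma cmod_factor_sq z : cmod z < 1 ->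
  1 - cmod (b z) ^+ 2 =
  (1 - cmod a ^+ 2) * (1 - cmod z ^+ 2) / cmod (1 - a^* * z) ^+ 2.
Proof.
move=> hz; have := moebius_den_neq0 hz; rewrite -cmod_gt0 => dz.
rewrite /blaschke_factor cmodM cmod_unimod mul1r cmodM cmodV exprMn.
rewrite cmod_moebius_num; field; exact: lt0r_neq0.
Qed.

Lemma cmod_factor z : cmod (b z) = cmod (a - z) / cmod (1 - a^* * z).
Proof. by rewrite /blaschke_factor cmodM cmod_unimod mul1r cmodM cmodV. Qed.

(** Equality in the Schwarz-Pick inequality, the base case for products. *)
Lemma cmod_dfactor z : cmod z < 1 ->
  cmod (db z) * (1 - cmod z ^+ 2) = 1 - cmod (b z) ^+ 2.
Proof.
move=> hz; rewrite cmod_factor_sq// /dblaschke_factor cmodN cmodM cmod_unimod.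
rewrite mul1r cmodM cmodV cmodX.
rewrite (_ : 1 - (cmod a)%:C ^+ 2 = (1 - cmod a ^+ 2)%:C); last first.
  by rewrite rmorphB rmorphXn.
rewrite cmodC ger0_norm; first by rewrite mulrAC.
by rewrite subr_ge0 expr_le1// ?ltW// cmod_ge0.
Qed.

Lemma cmod_factor_le1 z : cmod z < 1 -> cmod (b z) <= 1.
Proof.
move=> hz; rewrite -(@expr_le1 _ 2) ?cmod_ge0// -subr_ge0 cmod_factor_sq//.
by rewrite divr_ge0 ?exprn_ge0 ?cmod_ge0// mulr_ge0// subr_ge0 expr_le1 ?cmod_ge0// ltW.
Qed.

Lemma cmod_factor_lt1 z : cmod z < 1 -> cmod (b z) < 1.
Proof.
move=> hz; rewrite -(@expr_lt1 _ 2) ?cmod_ge0// -subr_gt0 cmod_factor_sq//.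
have := moebius_den_neq0 hz; rewrite -cmod_gt0 => dz.
by rewrite divr_gt0 ?exprn_gt0// mulr_gt0// subr_gt0 expr_lt1 ?cmod_ge0.
Qed.

Let sqa_le : 1 - cmod a ^+ 2 <= 2 * x.
Proof.
rewrite (_ : 1 - cmod a ^+ 2 = (1 + cmod a) * x); last by ring.
by apply: ler_wpM2r; move: a_lt1 => ?; lra.
Qed.

Let cmod_sqa : cmod (1 - (cmod a)%:C ^+ 2) <= 2 * x.
Proof.
rewrite (_ : 1 - (cmod a)%:C ^+ 2 = (1 - cmod a ^+ 2)%:C); last first.
  by rewrite rmorphB rmorphXn.
by rewrite cmodC ger0_norm// subr_ge0 expr_le1// ?ltW// cmod_ge0.
Qed.

Let x_ge0 : 0 <= x. Proof. by rewrite subr_ge0 ltW. Qed.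

(** The factors are normalized by the unimodular constant conj a / |a| for the
    sake of this bound, which makes the infinite product converge. *)
Lemma cmod_1Bfactor z : cmod z < 1 -> cmod (b z - 1) <= 2 * x / (1 - cmod z).
Proof.
move=> hz; have dz := moebius_den_neq0 hz.
have -> : b z - 1 =
    - (x%:C * ((a^* / (cmod a)%:C) * z + 1) / (1 - a^* * z)).
  rewrite /blaschke_factor rmorphB /=.
  rewrite [LHS](_ : _ = - (1 - (a^* * a) / (cmod a)%:C +
     (a^* / (cmod a)%:C - a^*) * z) / (1 - a^* * z)); last first.
    by field; rewrite dz.
  by rewrite conj_mulC ?rmorph1; field; rewrite dz ca_neq0.
rewrite cmodN cmodM cmodV cmodM cmodC (ger0_norm x_ge0) (mulrC 2).
apply: ler_pM; rewrite ?mulr_ge0 ?invr_ge0 ?cmod_ge0//.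
  apply: ler_wpM2l => //; apply: (le_trans (ler_cmodD _ _)).
  by rewrite cmodM cmod_unimod cmod1 mul1r; move: hz => ?; lra.
rewrite lef_pV2 ?posrE ?subr_gt0//; last by rewrite cmod_gt0.
exact: ler_moebius_den (ltW _).
Qed.

Section Increment.
Variables (z h : R[i]).
Hypothesis hz : cmod z < 1.
Hypothesis hh : cmod h <= (1 - cmod z) / 2.
Let d := 1 - cmod z.

Lemma cmod_shift : cmod (z + h) <= 1 - d / 2.
Proof. apply: (le_trans (ler_cmodD _ _)); move: hh; rewrite /d; lra. Qed.

Lemma cmod_shift_lt1 : cmod (z + h) < 1.
Proof. apply: (le_lt_trans cmod_shift); move: hz; rewrite /d; lra. Qed.

Let dz : 1 - a^* * z != 0. Proof. exact: moebius_den_neq0. Qed.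
Let dzh : 1 - a^* * (z + h) != 0.
Proof. exact: moebius_den_neq0 cmod_shift_lt1. Qed.

Let d_gt0 : 0 < d. Proof. by rewrite /d subr_gt0. Qed.

Let invz : (cmod (1 - a^* * z))^-1 <= d^-1.
Proof.
rewrite lef_pV2 ?posrE ?subr_gt0//; last by rewrite cmod_gt0.
exact: ler_moebius_den (ltW _).
Qed.

Let invzh : (cmod (1 - a^* * (z + h)))^-1 <= 2 / d.
Proof.
rewrite -[2 / d]invf_div lef_pV2 ?posrE ?cmod_gt0 ?divr_gt0//.
apply: (le_trans _ (ler_moebius_den (z + h) (ltW a_lt1))).
by have := cmod_shift; lra.
Qed.

Lemma factor_increment : cmod (b (z + h) - b z) <= cmod h * (4 * x / d ^+ 2).
Proof.
have -> : b (z + h) - b z = - (a^* / (cmod a)%:C *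
   (h * (1 - (cmod a)%:C ^+ 2) / (1 - a^* * z) / (1 - a^* * (z + h)))).
  by rewrite -conj_mulC /blaschke_factor; field; rewrite dz dzh ca_neq0.
rewrite cmodN cmodM cmod_unimod mul1r !cmodM !cmodV.
have -> : cmod h * (4 * x / d ^+ 2) = cmod h * (2 * x) / d * (2 / d).
  by field; exact: lt0r_neq0.
do ![apply: ler_pM; rewrite ?mulr_ge0 ?invr_ge0 ?cmod_ge0//].
Qed.

Lemma factor_taylor :
  cmod (b (z + h) - b z - h * db z) <= cmod h ^+ 2 * (4 * x / d ^+ 3).
Proof.
have -> : b (z + h) - b z - h * db z = - (a^* / (cmod a)%:C *
   (h ^+ 2 * a^* * (1 - (cmod a)%:C ^+ 2) / (1 - a^* * z) / (1 - a^* * z)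
     / (1 - a^* * (z + h)))).
  rewrite -conj_mulC /dblaschke_factor -conj_mulC /blaschke_factor.
  by field; rewrite dz dzh ca_neq0.
rewrite cmodN cmodM cmod_unimod mul1r !cmodM !cmodV.
have -> : cmod h ^+ 2 * (4 * x / d ^+ 3) =
  cmod h ^+ 2 * 1 * (2 * x) / d / d * (2 / d).
  by field; exact: lt0r_neq0.
do ![apply: ler_pM; rewrite ?cmodX ?exprn_ge0 ?mulr_ge0 ?invr_ge0 ?cmod_ge0//].
by rewrite cmod_conj ltW.
Qed.

End Increment.

Lemma cmod_dfactor_le z : cmod z < 1 ->
  cmod (db z) <= 2 * x / (1 - cmod z) ^+ 2.
Proof.
move=> hz; have dz := moebius_den_neq0 hz.
rewrite /dblaschke_factor cmodN cmodM cmod_unimod mul1r cmodM cmodV cmodX.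
apply: ler_pM; rewrite ?invr_ge0 ?exprn_ge0 ?cmod_ge0//.
rewrite lef_pV2 ?posrE ?exprn_gt0 ?subr_gt0 ?cmod_gt0//.
rewrite ler_pXn2r ?nnegrE ?cmod_ge0 ?subr_ge0 ?(ltW hz)//.
exact: ler_moebius_den (ltW _).
Qed.

End Factor.

(** * Sequences with summable increments *)

Section SummableIncrements.
Context {R : realType} (x : nat -> R) (S : R).
Hypothesis x_ge0 : forall n, 0 <= x n.
Local Notation X := (fun n => \sum_(0 <= k < n) x k).
Hypothesis XS : X n @[n --> \oo] --> S.

Definition tail n := S - \sum_(0 <= k < n) x k.

Lemma tail_cvg : tail n @[n --> \oo] --> (0 : R).
Proof. by rewrite -(subrr S); apply: cvgB => //; exact: cvg_cst. Qed.

Lemma psum_le n : \sum_(0 <= k < n) x k <= S.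
Proof.
have -> : S = limn X by apply/esym/cvg_lim.
apply: nondecreasing_cvgn_le; last by apply/cvg_ex; exists S.
by apply/nondecreasing_seqP => k; rewrite big_nat_recr//= lerDl.
Qed.

Lemma tail_ge0 n : 0 <= tail n.
Proof. by rewrite subr_ge0 psum_le. Qed.

Lemma tail_small C e : 0 < e -> \forall n \near \oo, C * tail n < e.
Proof.
move=> e0; have : (C * tail n) @[n --> \oo] --> (0 : R).
  by rewrite -(mulr0 C); apply: cvgM; [exact: cvg_cst | exact: tail_cvg].
by move=> h; exact: (cvgr_lt _ h _).
Qed.

(** Passage to the limit along an error controlled by [tail]. *)
Lemma ler_addtail (u v C : R) :
  (\forall n \near \oo, u <= v + C * tail n) -> u <= v.
Proof.
move=> uv; apply/ler_addgt0Pr => e e0; near \oo => n.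
have /le_trans : u <= v + C * tail n by near: n.
apply; rewrite lerD2l ltW//; near: n; exact: tail_small.
Unshelve. all: by end_near. Qed.

(** Adding a multiple of the convergent partial sums makes the sequence
    nondecreasing, which reduces convergence to the monotone case. *)
Lemma cvg_summable_increments_real (u : nat -> R) C :
  0 <= C -> (forall n, `|u n.+1 - u n| <= C * x n) -> cvgn u.
Proof.
move=> C0 hu.
pose v n := u n + C * \sum_(0 <= k < n) x k.
have vS n : v n.+1 - v n = u n.+1 - u n + C * x n.
  rewrite /v big_nat_recr//=; ring.
have ndv : nondecreasing_seq v.
  apply/nondecreasing_seqP => n; rewrite -subr_ge0 vS -lerBlDr sub0r.
  by have := hu n; rewrite ler_norml => /andP[].
have vub n : v n <= u 0%N + 2 * C * \sum_(0 <= k < n) x k.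
  elim: n => [|n IH]; first by rewrite /v !big_geq// !mulr0.
  rewrite -(subrK (v n) (v n.+1)) vS big_nat_recr//= mulrDr.
  have := hu n; rewrite ler_norml => /andP[_ h]; lra.
have cv : cvgn v.
  apply: nondecreasing_is_cvgn => //; exists (u 0%N + 2 * C * S) => _ [n _ <-].
  by apply: le_trans (vub n) _; rewrite lerD2l ler_wpM2l ?mulr_ge0// psum_le.
have -> : u = fun n => v n - C * \sum_(0 <= k < n) x k.
  by apply/funext => n; rewrite /v addrK.
apply: is_cvgB => //; apply: is_cvgM; first exact: is_cvg_cst.
by apply/cvg_ex; exists S.
Qed.

Lemma cvg_summable_increments (u : nat -> R[i]) C :
  0 <= C -> (forall n, cmod (u n.+1 - u n) <= C * x n) ->
  exists L, forall n, cmod (u n - L) <= C * tail n.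
Proof.
move=> C0 hu.
have reB (z w : R[i]) : complex.Re z - complex.Re w = complex.Re (z - w).
  by case: z w => [? ?] [].
have imB (z w : R[i]) : complex.Im z - complex.Im w = complex.Im (z - w).
  by case: z w => [? ?] [].
have cre : cvgn (fun n => complex.Re (u n)).
  apply: (cvg_summable_increments_real C0) => n.
  by rewrite reB (le_trans (ler_Re_cmod _)).
have cim : cvgn (fun n => complex.Im (u n)).
  apply: (cvg_summable_increments_real C0) => n.
  by rewrite imB (le_trans (ler_Im_cmod _)).
set l := limn (fun n => complex.Re (u n)).
set m := limn (fun n => complex.Im (u n)).
have diff n k : cmod (u n - u (n + k)%N) <=
    C * (\sum_(0 <= j < n + k) x j - \sum_(0 <= j < n) x j).
  elim: k => [|k IH]; first by rewrite addn0 !subrr cmod0 mulr0.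
  rewrite -(subrKA (u (n + k)%N)); apply: (le_trans (ler_cmodD _ _)).
  rewrite addnS big_nat_recr//= addrAC mulrDr; apply: lerD => //.
  by rewrite cmodB.
exists (l +i* m) => n; apply/ler_addgt0Pr => e e0.
near \oo => k.
rewrite -(subrKA (u (n + k)%N)); apply: (le_trans (ler_cmodD _ _)).
apply: lerD.
  apply: (le_trans (diff n k)); apply: ler_wpM2l => //.
  by rewrite lerD2r psum_le.
apply: (le_trans (ler_cmod_ReIm _)); rewrite -reB -imB /= (splitr e) lerD//.
- near: k; have : (complex.Re (u (n + k)%N)) @[k --> \oo] --> l.
    have := cre; rewrite -/l => h.
    exact: cvg_comp (cvg_addnl n) h.
  by move=> /cvgrPdistC_le; apply; rewrite divr_gt0.
- near: k; have : (complex.Im (u (n + k)%N)) @[k --> \oo] --> m.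
    have := cim; rewrite -/m => h.
    exact: cvg_comp (cvg_addnl n) h.
  by move=> /cvgrPdistC_le; apply; rewrite divr_gt0.
Unshelve. all: by end_near. Qed.

Lemma cmod_lim_le (u : nat -> R[i]) L C K :
  (forall n, cmod (u n - L) <= C * tail n) ->
  (\forall n \near \oo, cmod (u n) <= K) -> cmod L <= K.
Proof.
move=> hu hK; apply: (@ler_addtail _ _ C); near=> n.
rewrite -(subKr (u n) L); apply: (le_trans (ler_cmodB _ _)); apply: lerD => //.
by near: n.
Unshelve. all: by end_near. Qed.

End SummableIncrements.

(** * Limits and derivatives over the complex numbers *)

Section ComplexLimits.
Context {R : realType}.

Lemma lt0_complexP (e : R[i]) : 0 < e -> exists2 r : R, 0 < r & e = r%:C.
Proof.
case: e => r s; rewrite ltcE /= => /andP[/eqP -> r0]; exists r => //.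
Qed.

Lemma cmod_cvg_lim (u : nat -> R[i]^o) (L : R[i]^o) :
  (cmod (u n - L)) @[n --> \oo] --> (0 : R) -> lim (u n @[n --> \oo]) = L.
Proof.
move=> uL; apply: cvg_lim => //.
apply/cvgrPdist_lt => e /lt0_complexP[r r0 ->].
near=> n; rewrite normc_cmod ltcR cmodB; near: n.
exact: cvgr_lt _ uL _ r0.
Unshelve. all: by end_near. Qed.

(** A second-order Taylor bound is enough to identify the limit of the difference
    quotients over the complex field. *)
Lemma derive1_taylor (f : R[i]^o -> R[i]^o) (z g : R[i]^o) (d C : R) :
  0 < d -> 0 <= C ->
  (forall h : R[i], cmod h <= d -> cmod (f (z + h) - f z - h * g) <= C * cmod h ^+ 2) ->
  derive1 f z = g.
Proof.
move=> d0 C0 hf; rewrite /derive1; apply: cvg_lim => //.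
apply/cvgrPdist_le => e /lt0_complexP[r r0 ->].
near=> h.
have h0 : h != 0 by near: h; exact: nbhs_dnbhs_neq.
have hh : cmod h <= Num.min d (r / (C + 1)).
  rewrite -lecR -normc_cmod; near: h; apply: dnbhs0_le.
  by rewrite ltcR lt_min d0/= divr_gt0// ltr_wpDl.
rewrite normc_cmod lecR.
have -> : g - h^-1 *: (f (h + z) - f z) =
    (- ((h : R[i])^-1 * (f (z + h) - f z - h * g)) : R[i]).
  rewrite /GRing.scale/= (addrC h z); field; exact: h0.
rewrite cmodN cmodM cmodV.
have ch : 0 < cmod h by rewrite cmod_gt0.
rewrite mulrC ler_pdivrMr//; apply: (le_trans (hf _ _)).
  by apply: (le_trans hh); rewrite ge_min lexx.
rewrite expr2 mulrA ler_wpM2r ?cmod_ge0//.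
have : cmod h <= r / (C + 1) by apply: (le_trans hh); rewrite ge_min lexx orbT.
rewrite ler_pdivlMr ?ltr_wpDl// mulrDr mulr1 mulrC; apply: le_trans.
by rewrite lerDl cmod_ge0.
Unshelve. all: by end_near. Qed.

Lemma derivable_cmod_continuous (f : R[i]^o -> R[i]^o) (z : R[i]^o) :
  derivable f z 1 ->
  forall e : R, 0 < e -> exists2 d : R, 0 < d &
    forall w : R[i], cmod (w - z) < d -> cmod (f w - f z) < e.
Proof.
move=> /derivable1_diffP/differentiable_continuous fz e e0.
have /cvgrPdist_lt /(_ e%:C) := fz; rewrite ltcR => /(_ e0).
move=> /nbhs_normP[d /=] /lt0_complexP[r r0 ->] hd; exists r => // w wz.
have := hd w; rewrite /= normc_cmod ltcR cmodB => /(_ wz).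
by rewrite normc_cmod ltcR cmodB.
Qed.

End ComplexLimits.

(** * Partial products *)

Section PartialProducts.
Context {R : realType} (a : nat -> R[i]).
Hypothesis ha : forall n, 0 < cmod (a n) < 1.
Implicit Types z h : R[i].
Local Notation b k := (blaschke_factor (a k)).
Local Notation db k := (dblaschke_factor (a k)).
Local Notation x k := (1 - cmod (a k)).

Definition bprod n z : R[i] := \prod_(0 <= k < n) b k z.

Fixpoint dbprod n z : R[i] :=
  if n is m.+1 then dbprod m z * b m z + bprod m z * db m z else 0.

Lemma bprodS n z : bprod n.+1 z = bprod n z * b n z.
Proof. by rewrite /bprod big_nat_recr. Qed.

Lemma bdist_ge0 n : 0 <= x n.
Proof. by rewrite subr_ge0 ltW//; case/andP: (ha n). Qed.

Lemma cmod_bprod_le1 n z : cmod z < 1 -> cmod (bprod n z) <= 1.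
Proof.
move=> hz; elim: n => [|n IH]; first by rewrite /bprod big_geq// cmod1.
by rewrite bprodS cmodM mulr_ile1 ?cmod_ge0// cmod_factor_le1.
Qed.

Lemma cmod_bprod_le n k z : cmod z < 1 -> (k < n)%N ->
  cmod (bprod n z) <= cmod (b k z).
Proof.
move=> hz; elim: n => [//|n IH]; rewrite ltnS leq_eqVlt bprodS cmodM.
case/predU1P => [->|/IH h].
  by rewrite ler_piMl ?cmod_ge0 ?cmod_bprod_le1.
by rewrite (le_trans _ h)// ler_piMr ?cmod_ge0 ?cmod_factor_le1.
Qed.

(** Multiplying in one more factor of modulus at most 1 preserves the
    Schwarz-Pick inequality: for s, t in [0, 1],
    t (1 - s^2) + s (1 - t^2) = (1 - s^2 t^2) - (1 - s)(1 - t)(1 - s t). *)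
Lemma schwarz_pick_bprod n z : cmod z < 1 ->
  cmod (dbprod n z) * (1 - cmod z ^+ 2) <= 1 - cmod (bprod n z) ^+ 2.
Proof.
move=> hz; have hz2 : 0 <= 1 - cmod z ^+ 2.
  by rewrite subr_ge0 expr_le1 ?cmod_ge0// ltW.
elim: n => [|n IH]; first by rewrite /bprod big_geq//= cmod0 cmod1 mul0r expr1n subrr.
rewrite bprodS /=.
apply: (le_trans (ler_wpM2r hz2 (ler_cmodD _ _))).
rewrite (cmodM (dbprod n z)) !(cmodM (bprod n z)) mulrDl mulrAC.
rewrite -(mulrA (cmod (bprod n z))) (cmod_dfactor (ha n) hz).
have := cmod_bprod_le1 n hz; have := cmod_factor_le1 (ha n) hz.
have := cmod_ge0 (bprod n z); have := cmod_ge0 (b n z).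
move: IH; set u := _ * (1 - cmod z ^+ 2).
move: (cmod (b n z)) (cmod (bprod n z)) => t s IH t0 s0 t1 s1.
have : u * t <= (1 - s ^+ 2) * t by rewrite ler_wpM2r.
have h : 0 <= (1 - s) * (1 - t) * (1 - s * t).
  by rewrite !mulr_ge0 ?subr_ge0// mulr_ile1.
move=> ut; rewrite -subr_ge0.
rewrite (_ : _ - _ = (1 - s) * (1 - t) * (1 - s * t) + ((1 - s ^+ 2) * t - u * t));
  last by ring.
by rewrite addr_ge0// subr_ge0.
Qed.

(** Defects are subadditive because (1 - s^2) + (1 - t^2) - (1 - s^2 t^2) is the
    product of 1 - s^2 and 1 - t^2. *)
Lemma bprod_defect n z : cmod z < 1 ->
  1 - cmod (bprod n z) ^+ 2 <= \sum_(0 <= k < n) (1 - cmod (b k z) ^+ 2).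
Proof.
move=> hz; elim: n => [|n IH].
  by rewrite /bprod !big_geq// cmod1 expr1n subrr.
rewrite bprodS big_nat_recr//= (cmodM (bprod n z)) exprMn.
have := cmod_bprod_le1 n hz; have := cmod_factor_le1 (ha n) hz.
have := cmod_ge0 (bprod n z); have := cmod_ge0 (b n z).
move: IH; move: (cmod (b n z)) (cmod (bprod n z)) => t s IH t0 s0 t1 s1.
apply: le_trans (lerD IH (lexx _)).
have : 0 <= (1 - s ^+ 2) * (1 - t ^+ 2).
  by rewrite mulr_ge0// subr_ge0 expr_le1.
nra.
Qed.

Lemma cmod_dbprod_le n z : cmod z < 1 -> cmod (dbprod n z) <= (1 - cmod z)^-1.
Proof.
move=> hz; have d0 : 0 < 1 - cmod z by rewrite subr_gt0.
rewrite -[leRHS]mul1r ler_pdivlMr//.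
apply: le_trans (_ : cmod (dbprod n z) * (1 - cmod z ^+ 2) <= _).
  by rewrite ler_wpM2l ?cmod_ge0// lerD2l lerN2 expr2 ler_piMr ?cmod_ge0 ?ltW.
by apply: (le_trans (schwarz_pick_bprod n hz)); rewrite gerBl exprn_ge0 ?cmod_ge0.
Qed.

Lemma bprod_increment n z : cmod z < 1 ->
  cmod (bprod n.+1 z - bprod n z) <= 2 / (1 - cmod z) * x n.
Proof.
move=> hz; rewrite bprodS -{2}(mulr1 (bprod n z)) -mulrBr cmodM.
rewrite mulrAC; apply: le_trans (cmod_1Bfactor (ha n) hz).
by rewrite ler_piMl ?cmod_ge0 ?cmod_bprod_le1.
Qed.

Lemma dbprod_increment n z : cmod z < 1 ->
  cmod (dbprod n.+1 z - dbprod n z) <= 4 / (1 - cmod z) ^+ 2 * x n.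
Proof.
move=> hz; have d0 : 0 < 1 - cmod z by rewrite subr_gt0.
rewrite /= (_ : _ - _ = dbprod n z * (b n z - 1) + bprod n z * db n z); last by ring.
apply: (le_trans (ler_cmodD _ _)).
rewrite (cmodM (dbprod n z)) (cmodM (bprod n z)).
have -> : 4 / (1 - cmod z) ^+ 2 * x n = (1 - cmod z)^-1 * (2 * x n / (1 - cmod z))
   + 1 * (2 * x n / (1 - cmod z) ^+ 2).
  by field; rewrite lt0r_neq0.
apply: lerD; apply: ler_pM; rewrite ?cmod_ge0 ?cmod_dbprod_le ?cmod_bprod_le1//.
  exact: cmod_1Bfactor.
exact: cmod_dfactor_le.
Qed.

(** The constant involves the zeros only through the sum of the 1 - |a_k|, so
    the bound is uniform in [n]. *)
Lemma bprod_taylor n z h : cmod z < 1 -> cmod h <= (1 - cmod z) / 2 ->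
  cmod (bprod n (z + h) - bprod n z - h * dbprod n z) <=
  8 / (1 - cmod z) ^+ 3 * (\sum_(0 <= k < n) x k) * cmod h ^+ 2.
Proof.
move=> hz hh; have d0 : 0 < 1 - cmod z by rewrite subr_gt0.
elim: n => [|n IH].
  by rewrite /bprod !big_geq//= mulr0 subrr subr0 cmod0 mulr0 mul0r.
rewrite !bprodS /= big_nat_recr//= [leRHS](_ : _ =
  8 / (1 - cmod z) ^+ 3 * (\sum_(0 <= k < n) x k) * cmod h ^+ 2 +
  8 / (1 - cmod z) ^+ 3 * x n * cmod h ^+ 2); last by rewrite mulrDr mulrDl.
set E := (X in cmod X <= _) in IH.
rewrite (_ : _ - _ = E * b n (z + h) + (h * dbprod n z * (b n (z + h) - b n z) +
   bprod n z * (b n (z + h) - b n z - h * db n z))); last by rewrite /E; ring.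
apply: (le_trans (ler_cmodD _ _)); apply: lerD.
  rewrite cmodM; apply: le_trans IH; rewrite ler_piMr ?cmod_ge0//.
  exact/cmod_factor_le1/cmod_shift_lt1.
apply: (le_trans (ler_cmodD _ _)).
rewrite (cmodM (h * _)) (cmodM h) (cmodM (bprod n z)).
have -> : 8 / (1 - cmod z) ^+ 3 * x n * cmod h ^+ 2 =
   cmod h * (1 - cmod z)^-1 * (cmod h * (4 * x n / (1 - cmod z) ^+ 2))
   + 1 * (cmod h ^+ 2 * (4 * x n / (1 - cmod z) ^+ 3)).
  by field; rewrite lt0r_neq0.
apply: lerD; apply: ler_pM; rewrite ?mulr_ge0 ?cmod_ge0//.
- by rewrite ler_wpM2l ?cmod_ge0// cmod_dbprod_le.
- exact: factor_increment.
- exact: cmod_bprod_le1.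
- exact: factor_taylor.
Qed.

End PartialProducts.

(** * The infinite product *)

Section BlaschkeProduct.
Context {R : realType} (a : nat -> R[i]).
Hypothesis ha : forall n, 0 < cmod (a n) < 1.
Local Notation x := (fun k => 1 - cmod (a k)).
Variable S : R.
Hypothesis XS : \sum_(0 <= k < n) x k @[n --> \oo] --> S.
Implicit Types z h : R[i].
Local Notation B := (blaschke_product a).
Local Notation dB := (derive1 (blaschke_product a)).
Local Notation tl := (tail x S).

Let x0 n : 0 <= x n. Proof. exact: bdist_ge0. Qed.

Lemma bprod_tail n z : cmod z < 1 ->
  cmod (bprod a n z - B z) <= 2 / (1 - cmod z) * tl n.
Proof.
move=> hz; have d0 : 0 < 1 - cmod z by rewrite subr_gt0.
have C0 : 0 <= 2 / (1 - cmod z) by rewrite divr_ge0// ltW.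
have [L hL] := cvg_summable_increments x0 XS C0
  (fun n => bprod_increment ha n hz).
rewrite (_ : B z = L)//; apply: cmod_cvg_lim.
apply: (@squeeze_cvgr _ _ _ _ (fun=> 0) (fun n => 2 / (1 - cmod z) * tl n)).
- by near=> k; rewrite cmod_ge0/=; exact: hL.
- exact: cvg_cst.
- by rewrite -(mulr0 (2 / (1 - cmod z))); apply: cvgM; [exact: cvg_cst | exact: tail_cvg].
Unshelve. all: by end_near. Qed.

(** The second-order Taylor bounds of the partial products are uniform, hence
    pass to the limit and identify the derivative of the infinite product with
    the limit of the derivatives. *)
Lemma blaschke_taylor_dbprod z : cmod z < 1 ->
  (forall n, cmod (dbprod a n z - dB z) <= 4 / (1 - cmod z) ^+ 2 * tl n) /\
  (forall h, cmod h <= (1 - cmod z) / 2 ->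
    cmod (B (z + h) - B z - h * dB z) <=
      8 / (1 - cmod z) ^+ 3 * S * cmod h ^+ 2).
Proof.
move=> hz; have d0 : 0 < 1 - cmod z by rewrite subr_gt0.
have C0 : 0 <= 4 / (1 - cmod z) ^+ 2 by rewrite divr_ge0// exprn_ge0// ltW.
have S0 : 0 <= S by apply: le_trans (psum_le x0 XS 0); rewrite big_geq.
have [L hL] := cvg_summable_increments x0 XS C0
  (fun n => dbprod_increment ha n hz).
have tay h : cmod h <= (1 - cmod z) / 2 ->
    cmod (B (z + h) - B z - h * L) <= 8 / (1 - cmod z) ^+ 3 * S * cmod h ^+ 2.
  move=> hh; have hzh := cmod_shift_lt1 hz hh.
  apply: (@cmod_lim_le _ x S XS
    (fun n => bprod a n (z + h) - bprod a n z - h * dbprod a n z) _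
    (2 / (1 - cmod (z + h)) + 2 / (1 - cmod z) +
     cmod h * (4 / (1 - cmod z) ^+ 2))).
    move=> n.
    rewrite (_ : _ - _ = (bprod a n (z + h) - B (z + h)) - (bprod a n z - B z) -
       h * (dbprod a n z - L)); last by ring.
    apply: (le_trans (ler_cmodB _ _)).
    rewrite mulrDl (mulrDl _ _ (tl n)); apply: lerD.
      apply: (le_trans (ler_cmodB _ _)).
      by apply: lerD; exact: bprod_tail.
    by rewrite cmodM -mulrA ler_wpM2l ?cmod_ge0.
  near=> n; apply: (le_trans (bprod_taylor ha n hz hh)).
  rewrite ler_wpM2r ?exprn_ge0 ?cmod_ge0// ler_wpM2l ?psum_le//.
  by rewrite divr_ge0// exprn_ge0// ltW.
have -> : dB z = L; last by [].
apply: (@derive1_taylor _ _ _ _ ((1 - cmod z) / 2) _ _ _ tay).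
  by rewrite divr_gt0.
by rewrite mulr_ge0// divr_ge0// exprn_ge0// ltW.
Unshelve. all: by end_near. Qed.

Lemma cmod_blaschke_le z k : cmod z < 1 ->
  cmod (B z) <= cmod (blaschke_factor (a k) z).
Proof.
move=> hz; apply: (@cmod_lim_le _ x S XS (bprod a ^~ z) _ (2 / (1 - cmod z))) => [n|].
  exact: bprod_tail.
by near=> n; apply: cmod_bprod_le => //; near: n; exists k.+1.
Unshelve. all: by end_near. Qed.

Lemma cmod_blaschke_lt1 z : cmod z < 1 -> cmod (B z) < 1.
Proof.
move=> hz; apply: (le_lt_trans (cmod_blaschke_le 0 hz)).
exact: cmod_factor_lt1.
Qed.

Lemma bprod_blaschke_sq n z : cmod z < 1 ->
  `|cmod (bprod a n z) ^+ 2 - cmod (B z) ^+ 2| <= 4 / (1 - cmod z) * tl n.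
Proof.
move=> hz; rewrite subr_sqr normrM.
have h : `|cmod (bprod a n z) - cmod (B z)| <= 2 / (1 - cmod z) * tl n.
  apply: le_trans (bprod_tail n hz); rewrite ler_norml lerB_cmod andbT.
  by rewrite lerNl opprB cmodB lerB_cmod.
have -> : 4 / (1 - cmod z) * tl n = 2 / (1 - cmod z) * tl n * 2.
  by ring.
apply: ler_pM => //; rewrite ger0_norm ?addr_ge0 ?cmod_ge0//.
have := cmod_bprod_le1 ha n hz; have := cmod_blaschke_lt1 hz; lra.
Qed.

Lemma schwarz_pick_blaschke z : cmod z < 1 ->
  cmod (dB z) * (1 - cmod z ^+ 2) <= 1 - cmod (B z) ^+ 2.
Proof.
move=> hz; have [hD _] := blaschke_taylor_dbprod hz.
have hz2 : 0 <= 1 - cmod z ^+ 2.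
  by rewrite subr_ge0 expr_le1 ?cmod_ge0// ltW.
apply: (@ler_addtail _ x S XS _ _
  (4 / (1 - cmod z) ^+ 2 * (1 - cmod z ^+ 2) + 4 / (1 - cmod z))).
near=> n; rewrite mulrDl addrA.
have h1 : cmod (dB z) <= cmod (dbprod a n z) + 4 / (1 - cmod z) ^+ 2 * tl n.
  rewrite -lerBlDl; apply: le_trans (hD n); rewrite cmodB; exact: lerB_cmod.
have h2 := schwarz_pick_bprod ha n hz.
have := bprod_blaschke_sq n hz; rewrite ler_norml => /andP[h3 _].
have := ler_wpM2r hz2 h1; rewrite mulrDl (mulrAC (4 / _)) => h4.
lra.
Unshelve. all: by end_near. Qed.

End BlaschkeProduct.

(** * Calculus on an interval *)

Section Calculus.
Context {R : realType}.

Lemma is_derive_taylor (f : R -> R) (x g d C : R) : 0 < d -> 0 <= C ->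
  (forall h, `|h| <= d -> `|f (x + h) - f x - h * g| <= C * h ^+ 2) ->
  is_derive x 1 f g.
Proof.
move=> d0 C0 hf.
suff fg : h^-1 *: (f (h + x) - f x) @[h --> 0^'] --> g.
  have dfx : derivable f x 1.
    apply/cvg_ex; exists g; move: fg; apply: cvg_trans; apply: near_eq_cvg.
    by near=> h; rewrite /= (_ : h *: (1 : R) = h)// /GRing.scale/= mulr1.
  by apply: DeriveDef => //; rewrite -derive1E; exact: cvg_lim fg.
apply/cvgrPdist_le => e e0.
near=> h.
have h0 : h != 0 by near: h; exact: nbhs_dnbhs_neq.
have hh : `|h| <= Num.min d (e / (C + 1)).
  near: h; apply: dnbhs0_le.
  by rewrite lt_min d0/= divr_gt0// ltr_wpDl.
have -> : g - h^-1 *: (f (h + x) - f x) = - (h^-1 * (f (x + h) - f x - h * g)).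
  by rewrite /GRing.scale/= (addrC h x); field.
have ch : 0 < `|h| by rewrite normr_gt0.
rewrite normrN normrM normfV mulrC ler_pdivrMr//; apply: (le_trans (hf _ _)).
  by apply: (le_trans hh); rewrite ge_min lexx.
rewrite -real_normK ?num_real// expr2 mulrA ler_wpM2r//.
have : `|h| <= e / (C + 1) by apply: (le_trans hh); rewrite ge_min lexx orbT.
rewrite ler_pdivlMr ?ltr_wpDl// mulrDr mulr1 mulrC; apply: le_trans.
by rewrite lerDl.
Unshelve. all: by end_near. Qed.

Lemma is_derive1_continuous (f : R -> R) (x df : R) :
  is_derive x 1 f df -> {for x, continuous f}.
Proof.
by move=> [dfx _]; exact/differentiable_continuous/derivable1_diffP.
Qed.

Lemma within_continuous_itv (f : R -> R) (a b : R) :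
  (forall x, a <= x <= b -> {for x, continuous f}) ->
  {within `[a, b], continuous f}.
Proof.
move=> hf; apply/subspace_continuousP => x /=; rewrite in_itv/= => xab.
exact: cvg_within_filter (hf x xab).
Qed.

Lemma integral_derive (f F : R -> R) (a b : R) : a < b ->
  (forall x, a <= x <= b -> is_derive x 1 F (f x)) ->
  (forall x, a <= x <= b -> {for x, continuous f}) ->
  (\int[lebesgue_measure]_(x in `[a, b]) (f x)%:E = (F b - F a)%:E)%E.
Proof.
move=> ab dF cf; rewrite EFinB; apply: continuous_FTC2 => //.
- exact: within_continuous_itv.
- split => [x||].
  + rewrite in_itv/= => /andP[ax xb].
    by have [] := dF x; rewrite ?(ltW ax) ?(ltW xb).
  + apply: cvg_at_right_filter; apply: is_derive1_continuous.
    by apply: dF; rewrite lexx ltW.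
  + apply: cvg_at_left_filter; apply: is_derive1_continuous.
    by apply: dF; rewrite lexx ltW.
- move=> x; rewrite in_itv/= => /andP[ax xb]; rewrite derive1E.
  by have [|_ ->] := dF x; rewrite ?(ltW ax) ?(ltW xb).
Qed.

Lemma nondecreasing_derive (f df : R -> R) (a b : R) :
  (forall x, a <= x <= b -> is_derive x 1 f (df x)) ->
  (forall x, a <= x <= b -> 0 <= df x) -> a <= b -> f a <= f b.
Proof.
move=> hd h0 ab; apply: (@ger0_derive1_ndecr _ f a b) => // [x|x|].
- rewrite in_itv/= => /andP[ax xb].
  by have [] := hd x; rewrite ?(ltW ax) ?(ltW xb).
- rewrite in_itv/= => /andP[ax xb]; have xab : a <= x <= b by rewrite !ltW.
  by rewrite derive1E; have [_ ->] := hd x xab; exact: h0.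
- apply: within_continuous_itv => x /hd; exact: is_derive1_continuous.
Qed.

Lemma powRN_antitone (p u v : R) :
  0 < p -> 0 < u -> u <= v -> v `^ (- p) <= u `^ (- p).
Proof.
move=> p0 u0 uv; have v0 := lt_le_trans u0 uv.
rewrite !powRN lef_pV2 ?posrE ?powR_gt0//.
by apply: ge0_ler_powR; rewrite ?nnegrE ?(ltW p0) ?(ltW u0) ?(ltW v0).
Qed.

End Calculus.

(** * Self-maps of the disc along a radius *)

Section Radial.
Context {R : realType} (B dB : R[i] -> R[i]).
(* [B] is a holomorphic self-map of the disc; these four facts are all that is
   used about it and its derivative [dB]. *)
Hypothesis B_taylor : forall z, cmod z < 1 -> exists C d : R,
  [/\ 0 <= C, 0 < d & forall h, cmod h <= d ->
    cmod (B (z + h) - B z - h * dB z) <= C * cmod h ^+ 2].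
Hypothesis B_lt1 : forall z, cmod z < 1 -> cmod (B z) < 1.
Hypothesis B_pick : forall z, cmod z < 1 ->
  cmod (dB z) * (1 - cmod z ^+ 2) <= 1 - cmod (B z) ^+ 2.
Hypothesis dB_cont : forall z, cmod z < 1 -> forall e : R, 0 < e ->
  exists2 d : R, 0 < d & forall w, cmod (w - z) < d -> cmod (dB w - dB z) < e.
Implicit Types r s t : R.

Definition circ r t : R[i] := r%:C * (cos t +i* sin t).

Lemma cmod_expi t : cmod (cos t +i* sin t) = 1.
Proof. by rewrite /cmod /= cos2Dsin2 sqrtr1. Qed.

Lemma cmod_circ r t : cmod (circ r t) = `|r|.
Proof. by rewrite cmodM cmod_expi cmodC mulr1. Qed.

Lemma circD r s t : circ (r + s) t = circ r t + circ s t.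
Proof. by rewrite /circ rmorphD mulrDl. Qed.

(** The square keeps the defect differentiable at the zeros of [B]. *)
Definition defect r t : R := 1 - cmod (B (circ r t)) ^+ 2.

(** The radial derivative of [defect]. *)
Definition ddefect r t : R :=
  - 2 * complex.Re ((B (circ r t))^* * ((cos t +i* sin t) * dB (circ r t))).

Lemma defect_gt0 r t : `|r| < 1 -> 0 < defect r t.
Proof.
by move=> r1; rewrite subr_gt0 expr_lt1 ?cmod_ge0// B_lt1// cmod_circ.
Qed.

Lemma cmod_sqB (u v : R[i]) :
  cmod u ^+ 2 - cmod v ^+ 2 = 2 * complex.Re (v^* * (u - v)) + cmod (u - v) ^+ 2.
Proof. by rewrite !cmod_sq; case: u v => [x y] [x' y'] /=; ring. Qed.

Lemma is_derive_defect r t : `|r| < 1 -> is_derive r 1 (defect ^~ t) (ddefect r t).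
Proof.
move=> r1; set z := circ r t; have hz : cmod z < 1 by rewrite cmod_circ.
have [C [d [C0 d0 hB]]] := B_taylor hz.
set e := cos t +i* sin t.
apply: (@is_derive_taylor _ _ _ _ (Num.min d 1) (2 * C + (cmod (dB z) + C) ^+ 2)).
- by rewrite lt_min d0 ltr01.
- by rewrite addr_ge0 ?mulr_ge0 ?exprn_ge0// addr_ge0 ?cmod_ge0.
move=> h; rewrite le_min => /andP[hd h1].
have ch : cmod (circ h t) = `|h| by exact: cmod_circ.
have := hB (circ h t); rewrite ch => /(_ hd).
rewrite -circD; set E := (X in cmod X <= _) => hE.
have h2 : `|h| ^+ 2 = h ^+ 2 by rewrite real_normK ?num_real.
rewrite h2 in hE.
have diffE : B (circ (r + h) t) - B z = circ h t * dB z + E by rewrite /E; ring.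
rewrite (_ : _ - _ - _ = - (2 * complex.Re ((B z)^* * E) +
    cmod (B (circ (r + h) t) - B z) ^+ 2)); last first.
  rewrite (_ : defect _ _ - _ = - (cmod (B (circ (r + h) t)) ^+ 2 - cmod (B z) ^+ 2));
    last by rewrite /defect -/z; ring.
  rewrite cmod_sqB /ddefect -/z -/e; move: (cmod (_ - _) ^+ 2) => q.
  rewrite diffE {hE diffE} /circ -/e.
  case: (B z) (dB z) E e => [? ?] [? ?] [? ?] [? ?] /=; ring.
rewrite normrN; apply: (le_trans (ler_normD _ _)); rewrite [leRHS]mulrDl; apply: lerD.
  rewrite normrM ger0_norm// -mulrA ler_wpM2l//.
  apply: (le_trans (ler_Re_cmod _)); rewrite cmodM cmod_conj.
  by apply: le_trans hE; rewrite ler_piMl ?cmod_ge0// ltW// B_lt1.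
rewrite ger0_norm ?exprn_ge0 ?cmod_ge0// -h2 -exprMn.
rewrite ler_pXn2r ?nnegrE ?cmod_ge0 ?mulr_ge0 ?addr_ge0 ?cmod_ge0//.
rewrite diffE; apply: (le_trans (ler_cmodD _ _)).
rewrite cmodM ch [leRHS]mulrDl [in leRHS]mulrC lerD2l; apply: (le_trans hE).
by rewrite ler_wpM2l// -h2 expr2 ler_piMl.
Qed.

Lemma ddefect_le r t : `|r| < 1 -> `|ddefect r t| <= 2 * cmod (dB (circ r t)).
Proof.
move=> r1; rewrite /ddefect mulNr normrN normrM ger0_norm// ler_wpM2l//.
apply: (le_trans (ler_Re_cmod _)); rewrite cmodM (cmodM _ (dB _)).
rewrite cmod_conj cmod_expi mul1r.
by rewrite ler_piMl ?cmod_ge0// ltW// B_lt1// cmod_circ.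
Qed.

Lemma pick_defect r t : `|r| < 1 ->
  cmod (dB (circ r t)) * (1 - r ^+ 2) <= defect r t.
Proof.
move=> r1; have := @B_pick (circ r t); rewrite cmod_circ real_normK ?num_real//.
exact.
Qed.

(** Integrated form of the Schwarz-Pick inequality along a radius. It lets the
    ratio (1 - |B|^2) / (1 - r) at one outer radius dominate those at all inner
    radii, which replaces any use of boundary values. *)
Lemma defect_growth r s t : 0 <= r -> r <= s -> s < 1 ->
  defect r t * ((1 + r) / (1 - r)) <= defect s t * ((1 + s) / (1 - s)).
Proof.
move=> r0 rs s1.
pose df u := defect u t * (2 / (1 - u) ^+ 2) + (1 + u) / (1 - u) * ddefect u t.
have bnd u : r <= u <= s -> 0 <= u < 1.
  by move=> /andP[ru us]; rewrite (le_trans r0 ru) (le_lt_trans us).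
apply: (@nondecreasing_derive _ (fun u => defect u t * ((1 + u) / (1 - u))) df) => // u.
- move=> /bnd /andP[u0 u1].
  have u1' : `|u| < 1 by rewrite ger0_norm.
  have nz : 1 - u != 0 by rewrite subr_eq0 gt_eqF.
  have dw := is_derive_defect t u1'.
  have d1 : is_derive u 1 (fun v : R => (1 + v) / (1 - v)) (2 / (1 - u) ^+ 2).
    have dB1 : is_derive u 1 (cst 1 - id : R -> R) (-1).
      by apply: is_derive_eq; rewrite sub0r.
    have dV := is_deriveV (nz : (cst 1 - id : R -> R) u != 0) dB1.
    have dA : is_derive u 1 (cst 1 + id : R -> R) 1.
      by apply: is_derive_eq; rewrite add0r.
    apply: (is_derive_eq (is_deriveM dA dV)).
    by rewrite /GRing.scale/= !fctE /=; field.
  exact: is_deriveM dw d1.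
- move=> /bnd /andP[u0 u1].
  have u1' : `|u| < 1 by rewrite ger0_norm.
  have du : 0 < 1 - u by rewrite subr_gt0.
  have := ddefect_le t u1'; rewrite ler_norml => /andP[h _].
  have hp := pick_defect t u1'.
  have -> : df u = ((1 - u ^+ 2) * ddefect u t + 2 * defect u t) / (1 - u) ^+ 2.
    by rewrite /df; field; rewrite lt0r_neq0.
  rewrite divr_ge0 ?exprn_ge0 ?(ltW du)//.
  have u2 : 0 <= 1 - u ^+ 2 by rewrite subr_ge0 expr_le1// ltW.
  have := ler_wpM2l u2 h; lra.
Qed.

Lemma B_cont z : cmod z < 1 -> forall e : R, 0 < e ->
  exists2 d : R, 0 < d & forall w, cmod (w - z) < d -> cmod (B w - B z) < e.
Proof.
move=> hz e e0; have [C [d [C0 d0 hB]]] := B_taylor hz.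
set G := cmod (dB z) + C + 1.
have G0 : 0 < G by rewrite /G ltr_wpDl// addr_ge0// cmod_ge0.
exists (Num.min d (Num.min 1 (e / G))).
  by rewrite !lt_min d0 ltr01 divr_gt0.
move=> w; rewrite !lt_min => /and3P[wd w1].
rewrite ltr_pdivlMr//; apply: le_lt_trans.
have zw : z + (w - z) = w by rewrite addrC subrK.
have := hB (w - z) (ltW wd); rewrite zw; set E := (X in cmod X <= _) => hE.
rewrite (_ : B w - B z = (w - z) * dB z + E); last by rewrite /E; ring.
apply: (le_trans (ler_cmodD _ _)); rewrite cmodM /G -addrA mulrDr lerD2l.
apply: (le_trans hE); rewrite expr2 mulrC -mulrA ler_wpM2l ?cmod_ge0//.
have : cmod (w - z) * C <= 1 * C by rewrite ler_wpM2r// ltW.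
rewrite mul1r => h; apply: (le_trans h); lra.
Qed.

(** Continuity of a plane curve in terms of the real-valued modulus, so that it
    composes with real-valued functions of the point. *)
Definition ccontinuous_at (c : R -> R[i]) r :=
  forall e : R, 0 < e ->
  exists2 d : R, 0 < d & forall s, `|s - r| < d -> cmod (c s - c r) < e.

Lemma ccontinuous_circ (f : R[i] -> R[i]) r t :
  (forall z, cmod z < 1 -> forall e : R, 0 < e ->
    exists2 d : R, 0 < d & forall w, cmod (w - z) < d -> cmod (f w - f z) < e) ->
  `|r| < 1 -> ccontinuous_at (fun s => f (circ s t)) r.
Proof.
move=> hf r1 e e0; have hz : cmod (circ r t) < 1 by rewrite cmod_circ.
have [d d0 hd] := hf _ hz e e0; exists d => // s sr; apply: hd.
have -> : circ s t - circ r t = circ (s - r) t.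
  by rewrite circD /circ rmorphN mulNr.
by rewrite cmod_circ.
Qed.

Lemma ccontinuous_lipschitz (c : R -> R[i]) (phi : R[i] -> R) r :
  (forall z w, `|phi z - phi w| <= cmod (z - w)) ->
  ccontinuous_at c r -> {for r, continuous (fun s => phi (c s))}.
Proof.
move=> hphi hc; apply/cvgrPdist_lt => e e0.
have [d d0 hd] := hc e e0.
near=> s; apply: (le_lt_trans (hphi _ _)); rewrite cmodB; apply: hd.
by rewrite distrC; near: s; exact: cvgr_dist_lt.
Unshelve. all: by end_near. Qed.

Lemma ReB (z w : R[i]) : `|complex.Re z - complex.Re w| <= cmod (z - w).
Proof. by apply: le_trans (ler_Re_cmod _); case: z w => [? ?] [? ?]. Qed.

Lemma ImB (z w : R[i]) : `|complex.Im z - complex.Im w| <= cmod (z - w).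
Proof. by apply: le_trans (ler_Im_cmod _); case: z w => [? ?] [? ?]. Qed.

Lemma cmod_lipschitz (z w : R[i]) : `|cmod z - cmod w| <= cmod (z - w).
Proof. by rewrite ler_norml lerB_cmod andbT lerNl opprB cmodB lerB_cmod. Qed.

Lemma continuous_cmod_dB r t : `|r| < 1 ->
  {for r, continuous (fun s => cmod (dB (circ s t)))}.
Proof.
by move=> r1; apply: (ccontinuous_lipschitz cmod_lipschitz); exact: ccontinuous_circ.
Qed.

Lemma continuous_ddefect r t : `|r| < 1 -> {for r, continuous (ddefect ^~ t)}.
Proof.
move=> r1; have hB := ccontinuous_circ t B_cont r1.
have hdB := ccontinuous_circ t dB_cont r1.
have c1 := ccontinuous_lipschitz ReB hB.
have c2 := ccontinuous_lipschitz ImB hB.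
have c3 := ccontinuous_lipschitz ReB hdB.
have c4 := ccontinuous_lipschitz ImB hdB.
rewrite (_ : ddefect ^~ t = fun s => - 2 *
  (complex.Re (B (circ s t)) *
     (cos t * complex.Re (dB (circ s t)) - sin t * complex.Im (dB (circ s t)))
   + complex.Im (B (circ s t)) *
     (sin t * complex.Re (dB (circ s t)) + cos t * complex.Im (dB (circ s t)))));
  last first.
  apply/funext => s; rewrite /ddefect.
  by case: (B _) (dB _) => [? ?] [? ?] /=; ring.
apply: cvgM; first exact: cvg_cst.
apply: cvgD; apply: cvgM => //; [apply: cvgB | apply: cvgD].
all: by apply: cvgM; [exact: cvg_cst | ].
Qed.

Variable p : R.
Hypotheses (p0 : 0 < p) (p1 : p < 1).

(** The heart of the argument: since |dB| (1 - r^2) <= w and p < 1, the factor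
    w^(p-1) is at most (|dB| (1 - r))^(p-1) wherever dB is not 0. So the derivative of w^p involves
    only the p-th power of |dB|, and no maximal function is needed. *)
Lemma defect_powR_derivative_le r t : 0 <= r < 1 ->
  `|p * defect r t `^ (p - 1) * ddefect r t| <=
  2 * p * (cmod (dB (circ r t)) `^ p * (1 - r) `^ (p - 1)).
Proof.
move=> /andP[r0 r1]; have r1' : `|r| < 1 by rewrite ger0_norm.
rewrite normrM ger0_norm ?mulr_ge0 ?powR_ge0 ?(ltW p0)//.
have hp := pick_defect t r1'; have hd := ddefect_le t r1'.
set D := cmod _ in hp hd *.
have : 0 <= D by exact: cmod_ge0.
rewrite le_eqVlt => /predU1P[D0|D0].
  have -> : ddefect r t = 0.
    by apply/eqP; rewrite -normr_eq0 eq_le normr_ge0 andbT (le_trans hd)// -D0 mulr0.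
  by rewrite normr0 mulr0 !mulr_ge0 ?powR_ge0 ?(ltW p0).
have dr : 0 < 1 - r by rewrite subr_gt0.
have Dw : D * (1 - r) <= defect r t.
  by apply: le_trans hp; rewrite ler_wpM2l ?(ltW D0)// lerD2l lerN2 expr2 ler_piMr// ltW.
have p1' : 0 < 1 - p by rewrite subr_gt0.
have := powRN_antitone p1' (mulr_gt0 D0 dr) Dw.
rewrite opprB powRM ?(ltW D0) ?(ltW dr)// => h.
apply: le_trans (_ : p * (D `^ (p - 1) * (1 - r) `^ (p - 1)) * (2 * D) <= _).
  apply: ler_pM; rewrite ?mulr_ge0 ?powR_ge0 ?(ltW p0)//.
  by rewrite ler_wpM2l ?(ltW p0).
rewrite -(mulr_powRB1 (ltW D0) p0) le_eqVlt; apply/orP; left; apply/eqP; ring.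
Qed.

Lemma defect_powR_decay r s t : 0 <= r -> r < s -> s < 1 ->
  ((defect r t `^ p - defect s t `^ p)%:E <=
   \int[lebesgue_measure]_(u in `[r, s])
     (2 * p * (cmod (dB (circ u t)) `^ p * (1 - u) `^ (p - 1)))%:E)%E.
Proof.
move=> r0 rs s1.
have bnd u : r <= u <= s -> 0 <= u < 1.
  by move=> /andP[ru us]; rewrite (le_trans r0 ru) (le_lt_trans us).
have bnd' u : r <= u <= s -> `|u| < 1.
  by move=> /bnd /andP[u0 u1]; rewrite ger0_norm.
pose F u := - defect u t `^ p.
pose f u := - (p * defect u t `^ (p - 1) * ddefect u t).
have dF u : r <= u <= s -> is_derive u 1 F (f u).
  move=> /bnd' u1; have dw := is_derive_defect t u1.
  have dp := is_derive1_powR p (defect_gt0 t u1).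
  have dN := is_deriveN (@is_derive1_comp _ _ (defect^~ t) _ _ _ dp dw).
  exact: dN.
have cf u : r <= u <= s -> {for u, continuous f}.
  move=> /bnd' u1; apply: cvgN; apply: cvgM; last exact: continuous_ddefect.
  apply: cvgM; first exact: cvg_cst.
  have cw := is_derive1_continuous (is_derive_defect t u1).
  have cp := is_derive1_continuous (is_derive1_powR (p - 1) (defect_gt0 t u1)).
  exact: (@continuous_comp _ _ _ (defect^~ t) (@powR R ^~ (p - 1)) u cw cp).
have := integral_derive rs dF cf.
rewrite /F opprK addrC => <-.
apply: (le_trans (lee_abs _)).
have mf : measurable_fun `[r, s] f.
  apply: subspace_continuous_measurable_fun => //.
  exact: within_continuous_itv.
have mD : measurable_fun `[r, s] (fun u => cmod (dB (circ u t))).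
  apply: subspace_continuous_measurable_fun => //.
  by apply: within_continuous_itv => u /bnd'; exact: continuous_cmod_dB.
apply: (le_trans (le_abse_integral _ _ _)) => //.
  exact/measurable_EFinP.
apply: ge0_le_integral => //.
- by apply: measurableT_comp => //; exact/measurable_EFinP.
- apply/measurable_EFinP; apply: measurable_funM => //.
  apply: measurable_funM.
    by apply: (measurableT_comp (measurable_powR _) mD).
  apply: (measurableT_comp (measurable_powR _)).
  by apply: measurable_funB.
- move=> u; rewrite /= in_itv/= => /bnd u1; rewrite lee_fin normrN.
  exact: defect_powR_derivative_le.
Qed.

End Radial.

(** * Measurability of complex-valued functions *)

Section ComplexMeasurable.
Context {R : realType} d (T : measurableType d).
Implicit Types f g : T -> R[i].

Definition cmeasurable f :=
  measurable_fun setT (fun x => complex.Re (f x)) /\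
  measurable_fun setT (fun x => complex.Im (f x)).

Lemma cmeasurable_cst z : cmeasurable (fun=> z).
Proof. by split. Qed.

Lemma cmeasurableD f g : cmeasurable f -> cmeasurable g ->
  cmeasurable (fun x => f x + g x).
Proof.
move=> [f1 f2] [g1 g2]; split.
  rewrite (_ : (fun _ => _) = fun x => complex.Re (f x) + complex.Re (g x)).
    exact: measurable_funD.
  by apply/funext => x; case: (f x) (g x) => [? ?] [? ?].
rewrite (_ : (fun _ => _) = fun x => complex.Im (f x) + complex.Im (g x)).
  exact: measurable_funD.
by apply/funext => x; case: (f x) (g x) => [? ?] [? ?].
Qed.

Lemma cmeasurableM f g : cmeasurable f -> cmeasurable g ->
  cmeasurable (fun x => f x * g x).
Proof.
move=> [f1 f2] [g1 g2]; split.
  rewrite (_ : (fun _ => _) = fun x => complex.Re (f x) * complex.Re (g x) -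
      complex.Im (f x) * complex.Im (g x)).
    by apply: measurable_funB; exact: measurable_funM.
  by apply/funext => x; case: (f x) (g x) => [? ?] [? ?].
rewrite (_ : (fun _ => _) = fun x => complex.Re (f x) * complex.Im (g x) +
      complex.Im (f x) * complex.Re (g x)).
  by apply: measurable_funD; exact: measurable_funM.
by apply/funext => x; case: (f x) (g x) => [? ?] [? ?].
Qed.

Lemma cmeasurableN f : cmeasurable f -> cmeasurable (fun x => - f x).
Proof.
move=> mf; rewrite (_ : (fun _ => _) = fun x => (- 1) * f x).
  by apply: cmeasurableM => //; exact: cmeasurable_cst.
by apply/funext => x; rewrite mulN1r.
Qed.

Lemma cmeasurable_cmod f : cmeasurable f -> measurable_fun setT (fun x => cmod (f x)).
Proof.
move=> [f1 f2].
rewrite (_ : (fun _ => _) =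
   (fun x => (complex.Re (f x) ^+ 2 + complex.Im (f x) ^+ 2) `^ 2^-1)).
  apply: (measurableT_comp (measurable_powR _)).
  by apply: measurable_funD; exact: measurable_funX.
apply/funext => x; rewrite powR12_sqrt ?addr_ge0 ?sqr_ge0//.
by rewrite -cmod_sq sqrtr_sqr ger0_norm// cmod_ge0.
Qed.

Lemma cmeasurableV f : cmeasurable f -> cmeasurable (fun x => (f x)^-1).
Proof.
move=> mf; have [f1 f2] := mf.
have mi : measurable_fun setT (fun x => (cmod (f x) ^+ 2)^-1).
  rewrite (_ : (fun _ => _) = fun x => (cmod (f x) ^+ 2) `^ (- 1)).
    apply: (measurableT_comp (measurable_powR _)).
    exact/measurable_funX/cmeasurable_cmod.
  by apply/funext => x; rewrite powR_inv1// exprn_ge0// cmod_ge0.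
split.
  rewrite (_ : (fun _ => _) = fun x => complex.Re (f x) * (cmod (f x) ^+ 2)^-1).
    exact: measurable_funM.
  by apply/funext => x; rewrite cmod_sq; case: (f x).
rewrite (_ : (fun _ => _) = fun x => - complex.Im (f x) * (cmod (f x) ^+ 2)^-1).
  by apply: measurable_funM => //; exact: measurable_funN.
by apply/funext => x; rewrite cmod_sq; case: (f x) => ? ?; rewrite mulNr.
Qed.

Lemma cmeasurable_lim (u : nat -> T -> R[i]) g :
  (forall n, cmeasurable (u n)) ->
  (forall x, cmod (u n x - g x) @[n --> \oo] --> (0 : R)) -> cmeasurable g.
Proof.
move=> mu ug; split.
  apply: (@measurable_fun_cvg _ _ _ _ (fun n x => complex.Re (u n x))).
    by move=> n; have [] := mu n.
  move=> x _; apply/cvgrPdist_lt => e e0; near=> n.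
  apply: (le_lt_trans (ReB _ _)); rewrite cmodB; near: n.
  exact: cvgr_lt _ (ug x) _ e0.
apply: (@measurable_fun_cvg _ _ _ _ (fun n x => complex.Im (u n x))).
  by move=> n; have [] := mu n.
move=> x _; apply/cvgrPdist_lt => e e0; near=> n.
apply: (le_lt_trans (ImB _ _)); rewrite cmodB; near: n.
exact: cvgr_lt _ (ug x) _ e0.
Unshelve. all: by end_near. Qed.

End ComplexMeasurable.

Section BlaschkeMeasurable.
Context {R : realType} (a : nat -> R[i]).
Hypothesis ha : forall n, 0 < cmod (a n) < 1.
Local Notation x := (fun k => 1 - cmod (a k)).
Variable S : R.
Hypothesis XS : \sum_(0 <= k < n) x k @[n --> \oo] --> S.
Context d (T : measurableType d) (f : T -> R[i]).
Hypothesis mf : cmeasurable f.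
Hypothesis f1 : forall u, cmod (f u) < 1.

Let mden k : cmeasurable (fun u => 1 - (a k)^* * f u).
Proof.
apply: cmeasurableD; first exact: cmeasurable_cst.
by apply: cmeasurableN; apply: cmeasurableM => //; exact: cmeasurable_cst.
Qed.

Lemma cmeasurable_bprod n : cmeasurable (fun u => bprod a n (f u)).
Proof.
elim: n => [|n IH].
  rewrite (_ : (fun _ => _) = fun=> 1); first exact: cmeasurable_cst.
  by apply/funext => u; rewrite /bprod big_geq.
rewrite (_ : (fun _ => _) = fun u => bprod a n (f u) * blaschke_factor (a n) (f u));
  last by apply/funext => u; rewrite bprodS.
apply: cmeasurableM => //; apply: cmeasurableM; first exact: cmeasurable_cst.
apply: cmeasurableM; last exact: cmeasurableV.
by apply: cmeasurableD; [exact: cmeasurable_cst | exact: cmeasurableN].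
Qed.

Lemma cmeasurable_dbprod n : cmeasurable (fun u => dbprod a n (f u)).
Proof.
elim: n => [|n IH]; first exact: cmeasurable_cst.
apply: cmeasurableD; apply: cmeasurableM => //.
- apply: cmeasurableM; first exact: cmeasurable_cst.
  apply: cmeasurableM; last exact: cmeasurableV.
  by apply: cmeasurableD; [exact: cmeasurable_cst | exact: cmeasurableN].
- exact: cmeasurable_bprod.
- apply: cmeasurableN; apply: cmeasurableM; first exact: cmeasurable_cst.
  apply: cmeasurableM; first exact: cmeasurable_cst.
  by apply: cmeasurableV; apply: (@cmeasurableM _ _ _ (fun u => _) (fun u => _)).
Qed.

Let cvg0_tail (c : nat -> R) C : (forall n, 0 <= c n <= C * tail x S n) ->
  c n @[n --> \oo] --> (0 : R).
Proof.
move=> hc; apply: (@squeeze_cvgr _ _ _ _ (fun=> 0) (fun n => C * tail x S n)).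
- by near=> k; exact: hc.
- exact: cvg_cst.
- by rewrite -(mulr0 C); apply: cvgM; [exact: cvg_cst | exact: tail_cvg].
Unshelve. all: by end_near. Qed.

Lemma cmeasurable_blaschke : cmeasurable (fun u => blaschke_product a (f u)).
Proof.
apply: (cmeasurable_lim cmeasurable_bprod) => u.
apply: (@cvg0_tail _ (2 / (1 - cmod (f u)))) => n.
by rewrite cmod_ge0 bprod_tail.
Qed.

Lemma cmeasurable_dblaschke :
  cmeasurable (fun u => derive1 (blaschke_product a) (f u)).
Proof.
apply: (cmeasurable_lim cmeasurable_dbprod) => u.
apply: (@cvg0_tail _ (4 / (1 - cmod (f u)) ^+ 2)) => n.
have [h _] := blaschke_taylor_dbprod ha XS (f1 u).
by rewrite cmod_ge0 h.
Qed.

End BlaschkeMeasurable.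

Section Circle.
Context {R : realType}.

Lemma measurable_cos : measurable_fun setT (@cos R).
Proof. apply: continuous_measurable_fun; exact: continuous_cos. Qed.

Lemma measurable_sin : measurable_fun setT (@sin R).
Proof. apply: continuous_measurable_fun; exact: continuous_sin. Qed.

Lemma cmeasurable_circ d (T : measurableType d) (r t : T -> R) :
  measurable_fun setT r -> measurable_fun setT t ->
  cmeasurable (fun u => circ (r u) (t u)).
Proof.
move=> mr mt; apply: cmeasurableM; first by split.
by split; [exact: (measurableT_comp measurable_cos mt) |
           exact: (measurableT_comp measurable_sin mt)].
Qed.

End Circle.

(** * The Poisson integral of a Blaschke factor *)

Section PoissonIntegral.
Context {R : realType} (a : R[i]) (r : R).
Hypotheses (ha : 0 < cmod a < 1) (r0 : 0 <= r) (r1 : r < 1).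
Let x := complex.Re a.
Let y := complex.Im a.
Let U : R -> R := fun t => r * (x * cos t + y * sin t).
Let V : R -> R := fun t => r * (x * sin t - y * cos t).
Let rho2 : R := cmod a ^+ 2 * r ^+ 2.

Let UV t : U t ^+ 2 + V t ^+ 2 = rho2.
Proof.
rewrite /rho2 cmod_sq -/x -/y.
transitivity (r ^+ 2 * (x ^+ 2 + y ^+ 2) * (cos t ^+ 2 + sin t ^+ 2)).
  by rewrite /U /V; ring.
by rewrite cos2Dsin2; ring.
Qed.

Let a1 : cmod a ^+ 2 < 1.
Proof. by rewrite expr_lt1 ?cmod_ge0//; case/andP: ha. Qed.

Let rho_lt1 : rho2 < 1.
Proof.
apply: (@le_lt_trans _ _ (cmod a ^+ 2)) => //.
by rewrite ler_piMr ?exprn_ge0 ?cmod_ge0// expr_le1// ltW.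
Qed.

Let U_lt1 t : U t < 1.
Proof.
rewrite ltNge; apply/negP => U1; have := rho_lt1; rewrite -(UV t) ltNge => /negP; apply.
by rewrite (le_trans (_ : 1 <= U t ^+ 2)) ?lerDl ?sqr_ge0// exprn_ege1.
Qed.

Let dU (t : R) : is_derive t (1 : R) U (- V t).
Proof.
have h := is_deriveZ r
  (is_deriveD (is_deriveZ x (is_derive_cos t)) (is_deriveZ y (is_derive_sin t))).
by apply: (is_derive_eq h); rewrite /V /GRing.scale/=; ring.
Qed.

Let dV (t : R) : is_derive t (1 : R) V (U t).
Proof.
have h := is_deriveZ r
  (is_deriveB (is_deriveZ x (is_derive_sin t)) (is_deriveZ y (is_derive_cos t))).
by apply: (is_derive_eq h); rewrite /U /GRing.scale/=; ring.
Qed.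

Let dn t : cmod (1 - a^* * circ r t) ^+ 2 = (1 - U t) ^+ 2 + V t ^+ 2.
Proof.
rewrite cmod_sq /circ /U /V /x /y; case: (a) => [u v] /=; ring.
Qed.

Let dn_gt0 t : 0 < (1 - U t) ^+ 2 + V t ^+ 2.
Proof. by rewrite ltr_pwDl ?sqr_ge0// exprn_gt0// subr_gt0. Qed.

(* The argument of 1 - conj a * r e^{it}, which has positive real part, is up to
   a factor a periodic primitive of the oscillating part of the Poisson kernel;
   the increment of [P] over a period is therefore that of [t]. *)
Let P : R -> R := fun t => t + 2 * atan (V t / (1 - U t)).

Let dP (t : R) : is_derive t (1 : R) P ((1 - rho2) / ((1 - U t) ^+ 2 + V t ^+ 2)).
Proof.
have nz : 1 - U t != 0 by rewrite subr_eq0 gt_eqF.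
have nz2 := lt0r_neq0 (dn_gt0 t).
have d1 : is_derive t (1 : R) (cst 1 - U : R -> R) (V t).
  by apply: (is_derive_eq (is_deriveB (is_derive_cst _ _ _) (dU t))); rewrite sub0r opprK.
have d2 := is_deriveV (nz : (cst 1 - U : R -> R) t != 0) d1.
have d3 := is_deriveM (dV t) d2.
have d4 := is_derive1_comp (is_derive1_atan _) d3.
have d5 := is_deriveD (is_derive_id t (1 : R)) (is_deriveZ 2 d4).
apply: (is_derive_eq d5).
rewrite /GRing.scale/= !fctE /= -(UV t); field.
by rewrite nz nz2 /=.
Qed.

(** For a single factor 1 - |b|^2 is a multiple of the Poisson kernel, hence its
    integral is explicit. *)
Lemma integral_factor_defect :
  (\int[lebesgue_measure]_(t in `[0%R, (2 * pi)%R])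
     (1 - cmod (blaschke_factor a (circ r t)) ^+ 2)%:E =
   ((1 - cmod a ^+ 2) * (1 - r ^+ 2) / (1 - cmod a ^+ 2 * r ^+ 2) * (2 * pi))%:E)%E.
Proof.
set c := (X in (X * (2 * pi))%:E).
have pi2 : 0 < 2 * pi :> R by rewrite mulr_gt0// pi_gt0.
pose f t := c * ((1 - rho2) / ((1 - U t) ^+ 2 + V t ^+ 2)).
have fE t : 1 - cmod (blaschke_factor a (circ r t)) ^+ 2 = f t.
  have rn : cmod (circ r t) = r by rewrite cmod_circ ger0_norm.
  rewrite cmod_factor_sq// ?rn// dn /f /c /rho2; field.
  have nz : 1 - rho2 != 0 by rewrite subr_eq0 (gt_eqF rho_lt1).
  by rewrite (lt0r_neq0 (dn_gt0 t)) /= exprMn; exact: nz.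
under eq_integral do rewrite fE.
have -> : c * (2 * pi) = c * P (2 * pi) - c * P 0.
  rewrite -mulrBr /P; congr (c * _).
  have -> : V (2 * pi) = V 0.
    by rewrite /V mulr_natl sin2pi cos2pi sin0 cos0.
  have -> : U (2 * pi) = U 0.
    by rewrite /U mulr_natl sin2pi cos2pi sin0 cos0.
  ring.
have dcP (t : R) : is_derive t (1 : R) (fun s => c * P s) (f t).
  exact: (is_deriveZ c (dP t)).
apply: (@integral_derive _ f (fun t => c * P t) _ _ pi2) => t _.
rewrite /f.
have cU : U s @[s --> t] --> U t by exact: is_derive1_continuous (dU t).
have cV : V s @[s --> t] --> V t by exact: is_derive1_continuous (dV t).
have c1U : (1 - U s) @[s --> t] --> (1 - U t) by apply: cvgB => //; exact: cvg_cst.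
apply: cvgM; first exact: cvg_cst.
apply: cvgM; first exact: cvg_cst.
apply: cvgV; first exact/lt0r_neq0/dn_gt0.
rewrite expr2 (expr2 (V t)).
by apply: cvgD; apply: cvgM.
Qed.

End PoissonIntegral.

(** * Means over circles *)

Section CircleIntegral.
Context {R : realType}.
Local Notation mu := (@lebesgue_measure R).
Local Notation I := (`[0%R, (2 * pi)%R]%classic : set R).

Lemma pi2_gt0 : 0 < 2 * pi :> R. Proof. by rewrite mulr_gt0// pi_gt0. Qed.

Lemma integral_cst_itv (a b c : R) : a <= b ->
  (\int[mu]_(t in `[a, b]) c%:E = (c * (b - a))%:E)%E.
Proof.
rewrite integral_cst//= lebesgue_measure_itv/= lte_fin le_eqVlt.
move=> /predU1P[->|ab]; first by rewrite ltxx subrr mulr0 mule0.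
by rewrite ab EFinM EFinB.
Qed.

(** The exponent [p^-1] and the normalization are removed, and the supremum is
    turned into a real bound. *)
Lemma hardy_bound (p : R) (f : R[i]^o -> R[i]^o) : 0 < p -> hardy p f ->
  exists2 M : R, 0 <= M & forall r, 0 < r < 1 ->
    (\int[mu]_(t in I) (cmod (f (circ r t)) `^ p)%:E <= M%:E)%E.
Proof.
move=> p0 [_]; set s := ereal_sup _ => sfin.
have hs r : 0 < r < 1 -> (integral_mean p f r <= s)%E.
  by move=> r01; apply: ereal_sup_ubound; exists r => //=; rewrite in_itv.
have half : 0 < (2^-1 : R) < 1 by rewrite invr_gt0 ltr0n/= invf_lt1// ltr1n.
have s0 : (0 <= s)%E by apply: le_trans (hs _ half); exact: poweR_ge0.
have sE : s = (fine s)%:E by rewrite fineK// ge0_fin_numE.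
have s0' : 0 <= fine s by rewrite fine_ge0.
move: (fine s) s0' sE => sg sg0 sE.
exists (sg `^ p * (2 * pi)).
  by rewrite mulr_ge0 ?powR_ge0 ?(ltW pi2_gt0).
move=> r r01.
have := hs r r01; rewrite sE /integral_mean.
set J := (X in ((_ * X) `^ _ <= _)%E).
have J0 : (0 <= J)%E by apply: integral_ge0 => t _; rewrite lee_fin powR_ge0.
have cJ0 : (0 <= ((2 * pi)^-1)%:E * J)%E.
  by rewrite mule_ge0// lee_fin invr_ge0 ltW// pi2_gt0.
move=> h; have : (((2 * pi)^-1)%:E * J <= (sg `^ p)%:E)%E.
  rewrite [X in (X <= _)%E](_ : _ = (((2 * pi)^-1)%:E * J) `^ p^-1 `^ p)%E; last first.
    by rewrite -poweRrM mulVf ?lt0r_neq0// poweRe1.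
  rewrite -poweR_EFin.
  by apply: gt0_ler_poweR; rewrite ?(ltW p0) ?in_itv/= ?leey ?andbT ?poweR_ge0 ?lee_fin.
by rewrite muleC lee_pdivrMr// ?pi2_gt0// EFinM.
Qed.

End CircleIntegral.

Section BlaschkeMean.
Context {R : realType} (a : nat -> R[i]).
Hypothesis ha : forall n, 0 < cmod (a n) < 1.
Local Notation x := (fun k => 1 - cmod (a k)).
Variable S : R.
Hypothesis XS : \sum_(0 <= k < n) x k @[n --> \oo] --> S.
Local Notation mu := (@lebesgue_measure R).
Local Notation I := (`[0%R, (2 * pi)%R]%classic : set R).
Local Notation B := (blaschke_product a).
Local Notation dB := (derive1 (blaschke_product a)).
Local Notation tl := (tail x S).
Local Notation w := (defect B).

Let x0 n : 0 <= x n. Proof. exact: bdist_ge0. Qed.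

Let circ_lt1 (r t : R) : 0 <= r < 1 -> cmod (circ r t) < 1.
Proof. by case/andP=> r0 r1; rewrite cmod_circ ger0_norm. Qed.

Lemma defect_ge0 (r t : R) : 0 <= r < 1 -> 0 <= w r t.
Proof.
move=> r01; rewrite subr_ge0 expr_le1 ?cmod_ge0// ltW//.
exact/(cmod_blaschke_lt1 ha XS)/circ_lt1.
Qed.

Lemma measurable_defect (r : R) : 0 <= r < 1 -> measurable_fun setT (w r).
Proof.
move=> r01; apply: measurable_funB => //; apply: measurable_funX.
apply: cmeasurable_cmod; apply: (cmeasurable_blaschke ha XS).
  by apply: cmeasurable_circ.
by move=> t; exact: circ_lt1.
Qed.

Let factor_defect_le (k : nat) (r : R) : 0 <= r < 1 ->
  (\int[mu]_(t in I) (1 - cmod (blaschke_factor (a k) (circ r t)) ^+ 2)%:E <=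
    (4 * pi * Num.min (1 - r) (x k))%:E)%E.
Proof.
move=> /andP[r0 r1]; rewrite integral_factor_defect// lee_fin.
have /andP[a0 a1] := ha k; set A := cmod (a k) in a0 a1 *.
have [A2 r2] : A ^+ 2 < 1 /\ r ^+ 2 < 1 by rewrite !expr_lt1// ltW.
have A20 : 0 <= A ^+ 2 by rewrite exprn_ge0// ltW.
have r20 : 0 <= r ^+ 2 by rewrite exprn_ge0.
have Ar : 0 < 1 - A ^+ 2 * r ^+ 2.
  rewrite subr_gt0 (le_lt_trans _ A2)// ler_piMr// ltW//.
rewrite (_ : 4 * pi * _ = 2 * Num.min (1 - r) (1 - A) * (2 * pi)); last by ring.
rewrite ler_wpM2r ?(ltW pi2_gt0)// ler_pdivrMr//.
have h1 : 0 <= (1 - A ^+ 2) * (1 - r ^+ 2) by rewrite mulr_ge0// subr_ge0 ltW.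
rewrite /Num.min; case: ifP => _.
  apply: (@le_trans _ _ ((1 - A ^+ 2 * r ^+ 2) * (1 - r ^+ 2))).
    by rewrite ler_wpM2r ?subr_ge0 ?(ltW r2)// lerD2l lerN2 ler_piMr// ltW.
  by rewrite mulrC ler_wpM2r ?(ltW Ar)//; nra.
apply: (@le_trans _ _ ((1 - A ^+ 2) * (1 - A ^+ 2 * r ^+ 2))).
  by rewrite ler_wpM2l ?subr_ge0 ?(ltW A2)// lerD2l lerN2 ler_piMl// ltW.
by rewrite ler_wpM2r ?(ltW Ar)//; nra.
Qed.

(** In the mean over circles a Blaschke product tends to modulus 1: the defects
    of the first [N] factors vanish at the circle, those of the others are
    bounded by a tail of the convergent series. *)
Lemma mean_defect_le (N : nat) (r : R) : 0 <= r < 1 ->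
  (\int[mu]_(t in I) (w r t)%:E <= (4 * pi * (N%:R * (1 - r) + tl N))%:E)%E.
Proof.
move=> r01; have /andP[r0 r1] := r01.
have dr : 0 < 1 - r by rewrite subr_gt0.
pose bd k (t : R) := 1 - cmod (blaschke_factor (a k) (circ r t)) ^+ 2.
have bd0 k t : 0 <= bd k t.
  by rewrite subr_ge0 expr_le1 ?cmod_ge0// cmod_factor_le1// circ_lt1.
have mbd k : measurable_fun setT (bd k).
  apply: measurable_funB => //; apply: measurable_funX; apply: cmeasurable_cmod.
  have mc : cmeasurable (fun t => circ r t) by exact: cmeasurable_circ.
  apply: cmeasurableM; first exact: cmeasurable_cst.
  apply: cmeasurableM.
    by apply: cmeasurableD; [exact: cmeasurable_cst | exact: cmeasurableN].
  apply: cmeasurableV; apply: cmeasurableD; first exact: cmeasurable_cst.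
  by apply: cmeasurableN; apply: cmeasurableM => //; exact: cmeasurable_cst.
have step n : (N <= n)%N -> (\int[mu]_(t in I) (w r t)%:E <=
    (4 * pi * (N%:R * (1 - r) + tl N) + 4 / (1 - r) * (2 * pi) * tl n)%:E)%E.
  move=> Nn; apply: (@le_trans _ _ (\int[mu]_(t in I)
      (\sum_(k <- index_iota 0 n) (bd k t)%:E + (4 / (1 - r) * tl n)%:E))%E).
    apply: ge0_le_integral => //.
    - by move=> t _; rewrite lee_fin defect_ge0.
    - by apply/measurable_EFinP; apply: measurable_funTS; exact: measurable_defect.
    - apply: emeasurable_funD => //; apply: emeasurable_sum => k.
      by apply/measurable_EFinP; apply: measurable_funTS; exact: mbd.
    - move=> t _; rewrite sumEFin -EFinD lee_fin.
      have ct := circ_lt1 t r01.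
      have h1 := bprod_defect ha n ct.
      have := bprod_blaschke_sq ha XS n ct; rewrite cmod_circ (ger0_norm r0).
      rewrite ler_norml => /andP[_ h2].
      rewrite /defect; apply: le_trans (lerD h1 h2); lra.
  rewrite ge0_integralD//; last 3 first.
  - by move=> t _; apply: sume_ge0 => k _; rewrite lee_fin.
  - apply: emeasurable_sum => k.
    by apply/measurable_EFinP; apply: measurable_funTS; exact: mbd.
  - by move=> t _; rewrite lee_fin mulr_ge0 ?divr_ge0 ?(ltW dr)// tail_ge0.
  rewrite integral_cst_itv ?(ltW pi2_gt0)// subr0 ge0_integral_sum//; last 2 first.
  - by move=> k; apply/measurable_EFinP; apply: measurable_funTS; exact: mbd.
  - by move=> k t _; rewrite lee_fin.
  rewrite EFinD; apply: leeD; last first.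
    by rewrite lee_fin mulrAC.
  apply: (@le_trans _ _ (\sum_(0 <= k < n) (4 * pi * Num.min (1 - r) (x k))%:E)%E).
    by apply: lee_sum => k _; exact: factor_defect_le.
  rewrite sumEFin lee_fin -mulr_sumr ler_wpM2l ?mulr_ge0 ?pi_ge0//.
  rewrite (big_cat_nat _ Nn)//=; apply: lerD.
    apply: (@le_trans _ _ (\sum_(0 <= k < N) (1 - r))).
      by apply: ler_sum => k _; rewrite ge_min lexx.
    by rewrite sumr_const_nat subn0 mulr_natl.
  apply: (@le_trans _ _ (\sum_(N <= k < n) x k)).
    by apply: ler_sum => k _; rewrite ge_min lexx orbT.
  have := psum_le x0 XS n; rewrite (big_cat_nat _ Nn)//= /tail; lra.
set J := (X in (X <= _)%E).
have J0 : (0 <= J)%E by apply: integral_ge0 => t _; rewrite lee_fin defect_ge0.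
have JE : J = (fine J)%:E.
  by rewrite fineK// ge0_fin_numE// (le_lt_trans (step N (leqnn N)))// ltry.
rewrite JE lee_fin.
apply: (@ler_addtail _ x S XS _ _ (4 / (1 - r) * (2 * pi))).
near=> n; rewrite -lee_fin -JE; apply: step; near: n; exact: nbhs_infty_ge.
Unshelve. all: by end_near. Qed.

Variable p : R.
Hypotheses (p0 : 0 < p) (p1 : p < 1).

(** With this bound a small mean of [u] forces a small mean of [u `^ p]. *)
Lemma powR_le_affine (e u : R) : 0 < e -> 0 <= u -> u `^ p <= e `^ p + e `^ (p - 1) * u.
Proof.
move=> e0 u0; have [ue|eu] := leP u e.
  apply: ler_wpDr; first by rewrite mulr_ge0 ?powR_ge0.
  by apply: ge0_ler_powR; rewrite ?nnegrE ?(ltW p0) ?(ltW e0).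
apply: ler_wpDl; first exact: powR_ge0.
rewrite -(mulr_powRB1 u0 p0) mulrC ler_wpM2r//.
rewrite -(opprB 1 p); apply: powRN_antitone => //; last exact: ltW.
by rewrite subr_gt0.
Qed.

Lemma mean_defect_powR_small (e : R) : 0 < e ->
  exists2 r0 : R, 0 <= r0 < 1 & forall r, r0 <= r < 1 ->
    (\int[mu]_(t in I) (w r t `^ p)%:E <= e%:E)%E.
Proof.
move=> e0; pose d := (e / (4 * pi)) `^ p^-1.
have pi0 := @pi_gt0 R.
have q0 : 0 < e / (4 * pi) by rewrite divr_gt0// mulr_gt0.
have d0 : 0 < d by rewrite powR_gt0.
have dp : d `^ p = e / (4 * pi) by rewrite /d -powRrM mulVf ?lt0r_neq0// powRr1// ltW.
pose G := d `^ (p - 1); have G0 : 0 < G by rewrite powR_gt0.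
pose q := e / (16 * pi * G).
have qq : 0 < q by rewrite divr_gt0// !mulr_gt0.
have [N hN] : exists N, tl N < q.
  have h := tail_small XS 1 qq; near \oo => n; exists n; rewrite -[tl n]mul1r.
  by near: n.
exists (Num.max 0 (1 - q / N.+1%:R)).
  by rewrite le_max lexx/= gt_max ltr01/= gtrBl divr_gt0.
move=> r; rewrite ge_max -andbA => /and3P[r0 rq r1].
have r01 : 0 <= r < 1 by rewrite r0.
have Nq : N%:R * (1 - r) <= q.
  apply: (@le_trans _ _ (N.+1%:R * (1 - r))).
    by rewrite ler_wpM2r ?subr_ge0 ?(ltW r1)// ler_nat.
  by rewrite mulrC -ler_pdivlMr// lerBlDr addrC -lerBlDr.
apply: (@le_trans _ _ (\int[mu]_(t in I) ((d `^ p)%:E + G%:E * (w r t)%:E))%E).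
  apply: ge0_le_integral => //.
  - by move=> t _; rewrite lee_fin powR_ge0.
  - apply/measurable_EFinP; apply: measurable_funTS.
    exact: (measurableT_comp (measurable_powR _) (measurable_defect r01)).
  - apply: emeasurable_funD => //; apply/measurable_EFinP; apply: measurable_funTS.
    by apply: measurable_funM => //; exact: measurable_defect.
  - move=> t _; rewrite -EFinM -EFinD lee_fin powR_le_affine//; exact: defect_ge0.
rewrite ge0_integralD//; last 3 first.
- by move=> t _; rewrite lee_fin powR_ge0.
- by move=> t _; rewrite -EFinM lee_fin mulr_ge0 ?(ltW G0)// defect_ge0.
- apply/measurable_EFinP; apply: measurable_funTS.
  by apply: measurable_funM => //; exact: measurable_defect.
rewrite integral_cst_itv ?(ltW pi2_gt0)// subr0 ge0_integralZl_EFin ?(ltW G0)//;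
  last 2 first.
- by move=> t _; rewrite lee_fin defect_ge0.
- by apply/measurable_EFinP; apply: measurable_funTS; exact: measurable_defect.
apply: (@le_trans _ _ ((d `^ p * (2 * pi))%:E +
    G%:E * (4 * pi * (N%:R * (1 - r) + tl N))%:E)%E).
  by rewrite leeD2l// lee_pmul2l ?lte_fin//; exact: mean_defect_le.
rewrite -EFinM -EFinD lee_fin dp.
have h : N%:R * (1 - r) + tl N <= 2 * q.
  by rewrite (_ : 2 * q = q + q); [exact: lerD Nq (ltW hN) | ring].
apply: (@le_trans _ _ (e / (4 * pi) * (2 * pi) + G * (4 * pi * (2 * q)))).
  by rewrite lerD2l ler_wpM2l ?(ltW G0)// ler_wpM2l// mulr_ge0// ltW.
rewrite le_eqVlt; apply/orP; left; apply/eqP; rewrite /q.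
move: (lt0r_neq0 pi0) (lt0r_neq0 G0); move: (pi : R) (G) => P g P0 g0; field.
by rewrite P0 g0.
Unshelve. all: by end_near. Qed.

End BlaschkeMean.

(** * Decay of the defect in the p-th mean *)

Section TonelliRectangle.
Context {R : realType}.
Local Notation mu := (@lebesgue_measure R).

Lemma tonelli_rectangle (K : R -> R -> R) (A T : set R) :
  measurable A -> measurable T -> (forall s t, 0 <= K s t) ->
  measurable_fun setT (fun st : R * R => K st.1 st.2) ->
  (\int[mu]_(t in T) \int[mu]_(s in A) (K s t)%:E =
   \int[mu]_(s in A) \int[mu]_(t in T) (K s t)%:E)%E.
Proof.
move=> mA mT K0 mK.
pose f (st : R * R) := ((\1_A st.1 * \1_T st.2 * K st.1 st.2)%:E)%E.
have m1 : measurable_fun setT (fun st : R * R => (\1_A st.1 : R)).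
  exact: measurableT_comp (measurable_indic mA) measurable_fst.
have m2 : measurable_fun setT (fun st : R * R => (\1_T st.2 : R)).
  exact: measurableT_comp (measurable_indic mT) measurable_snd.
have mf : measurable_fun setT f.
  apply/measurable_EFinP; apply: measurable_funM => //.
  exact: measurable_funM.
have f0 st : (0 <= f st)%E by rewrite lee_fin !mulr_ge0.
have := @fubini_tonelli _ _ _ _ R mu mu f mf f0.
have e1 : (\int[mu]_s \int[mu]_t f (s, t) =
    \int[mu]_(s in A) \int[mu]_(t in T) (K s t)%:E)%E.
  rewrite [RHS]integral_mkcond; apply: eq_integral => s _.
  rewrite patchE /f; case: ifPn => sA.
    rewrite [RHS]integral_mkcond; apply: eq_integral => t _.
    rewrite patchE /= !indicE sA mul1r.
    by case: ifPn => tT; rewrite ?(negbTE tT) ?tT ?mul1r ?mul0r.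
  by apply: integral0_eq => t _; rewrite /= !indicE (negbTE sA) !mul0r.
have e2 : (\int[mu]_t \int[mu]_s f (s, t) =
    \int[mu]_(t in T) \int[mu]_(s in A) (K s t)%:E)%E.
  rewrite [RHS]integral_mkcond; apply: eq_integral => t _.
  rewrite patchE /f; case: ifPn => tT.
    rewrite [RHS]integral_mkcond; apply: eq_integral => s _.
    rewrite patchE /= !indicE tT mulr1.
    by case: ifPn => sA; rewrite ?(negbTE sA) ?sA ?mul1r ?mul0r.
  by apply: integral0_eq => s _; rewrite /= !indicE (negbTE tT) mulr0 mul0r.
rewrite e1 e2; exact: esym.
Qed.

Lemma measurable_integral_rectangle (K : R -> R -> R) (A : set R) :
  measurable A -> (forall s t, 0 <= K s t) ->
  measurable_fun setT (fun st : R * R => K st.1 st.2) ->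
  measurable_fun setT (fun t => \int[mu]_(s in A) (K s t)%:E)%E.
Proof.
move=> mA K0 mK.
pose f (st : R * R) := ((\1_A st.1 * K st.1 st.2)%:E)%E.
have m1 : measurable_fun setT (fun st : R * R => (\1_A st.1 : R)).
  exact: measurableT_comp (measurable_indic mA) measurable_fst.
have mf : measurable_fun setT f.
  by apply/measurable_EFinP; apply: measurable_funM.
have f0 st : (0 <= f st)%E by rewrite lee_fin mulr_ge0.
have := @measurable_fun_fubini_tonelli_G _ _ _ _ R mu f mf f0.
congr measurable_fun; apply/funext => t; rewrite [RHS]integral_mkcond.
apply: eq_integral => s _; rewrite patchE /f /= indicE.
by case: ifPn => sA; rewrite ?sA ?(negbTE sA) ?mul1r ?mul0r.
Qed.

Lemma integral_powR_weight (p r s : R) : 0 < p -> r < s -> s < 1 ->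
  (\int[mu]_(u in `[r, s]) ((1 - u) `^ (p - 1))%:E =
   (((1 - r) `^ p - (1 - s) `^ p) / p)%:E)%E.
Proof.
move=> p0 rs s1.
pose F u : R := - (p^-1 * (1 - u) `^ p).
pose f u : R := (1 - u) `^ (p - 1).
have du (u : R) : is_derive u (1 : R) (cst 1 - id : R -> R) (-1).
  by apply: is_derive_eq; rewrite sub0r.
have pos u : r <= u <= s -> 0 < 1 - u.
  by move=> /andP[_ us]; rewrite subr_gt0 (le_lt_trans us).
have dF u : r <= u <= s -> is_derive u (1 : R) F (f u).
  move=> /pos u1; have dp := is_derive1_powR p u1.
  have d1 := @is_derive1_comp _ _ (cst 1 - id : R -> R) _ _ _ dp (du u).
  have d2 := is_deriveN (is_deriveZ p^-1 d1).
  apply: (is_derive_eq d2); rewrite /f /GRing.scale/=; field.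
  exact: lt0r_neq0.
have cf u : r <= u <= s -> {for u, continuous f}.
  move=> /pos u1.
  have c1 := is_derive1_continuous (du u).
  have c2 := is_derive1_continuous (is_derive1_powR (p - 1) u1).
  exact: (@continuous_comp _ _ _ (cst 1 - id : R -> R) (@powR R ^~ (p - 1)) u c1 c2).
rewrite (_ : ((1 - r) `^ p - (1 - s) `^ p) / p = F s - F r); last first.
  by rewrite /F mulrC; ring.
exact: (integral_derive rs dF cf).
Qed.

End TonelliRectangle.

Section Decay.
Context {R : realType} (a : nat -> R[i]).
Hypothesis ha : forall n, 0 < cmod (a n) < 1.
Local Notation x := (fun k => 1 - cmod (a k)).
Variable S : R.
Hypothesis XS : \sum_(0 <= k < n) x k @[n --> \oo] --> S.
Local Notation mu := (@lebesgue_measure R).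
Local Notation I := (`[0%R, (2 * pi)%R]%classic : set R).
Local Notation B := (blaschke_product a).
Local Notation dB := (derive1 (blaschke_product a)).
Local Notation w := (defect B).
Variables (p M : R).
Hypotheses (p0 : 0 < p) (p1 : p < 1) (M0 : 0 <= M).
Hypothesis dB_cont : forall z, cmod z < 1 -> forall e : R, 0 < e ->
  exists2 d : R, 0 < d & forall u : R[i], cmod (u - z) < d -> cmod (dB u - dB z) < e.
Hypothesis dB_hardy : forall r, 0 < r < 1 ->
  (\int[mu]_(t in I) (cmod (dB (circ r t)) `^ p)%:E <= M%:E)%E.

Lemma blaschke_taylor z : cmod z < 1 -> exists C d : R,
  [/\ 0 <= C, 0 < d & forall h : R[i], cmod h <= d ->
    cmod (B (z + h) - B z - h * dB z) <= C * cmod h ^+ 2].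
Proof.
move=> hz; have [_ ht] := blaschke_taylor_dbprod ha XS hz.
exists (8 / (1 - cmod z) ^+ 3 * S), ((1 - cmod z) / 2); split => //.
  rewrite mulr_ge0 ?divr_ge0 ?exprn_ge0 ?subr_ge0 ?(ltW hz)//.
  by apply: le_trans (psum_le (bdist_ge0 ha) XS 0); rewrite big_geq.
by rewrite divr_gt0// subr_gt0.
Qed.

(** Truncating the radius at [rho] < 1 keeps the point inside the disc, so that
    measurability can be stated on the whole plane. *)
Lemma measurable_dblaschke_weight (rho : R) : 0 <= rho < 1 ->
  let clip s := Num.max 0 (Num.min s rho) in
  measurable_fun setT (fun st : R * R =>
    cmod (dB (circ (clip st.1) st.2)) `^ p * (1 - clip st.1) `^ (p - 1)).
Proof.
move=> /andP[rho0 rho1] clip.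
have mclip : measurable_fun setT (fun st : R * R => clip st.1).
  by apply: measurable_maxr => //; apply: measurable_minr.
apply: measurable_funM; apply: (measurableT_comp (measurable_powR _)).
  apply: cmeasurable_cmod; apply: (cmeasurable_dblaschke ha XS).
    by apply: cmeasurable_circ.
  move=> st; rewrite cmod_circ ger0_norm ?le_max ?lexx//.
  by rewrite gt_max ltr01/= gt_min rho1 orbT.
exact: measurable_funB.
Qed.

(** The boundary term at radius [s] disappears in the limit because B is inner;
    what remains is the integral of (1 - u)^(p-1) times the bounded p-th means
    of the derivative. *)
Lemma mean_defect_powR_decay (r : R) : 0 < r < 1 ->
  (\int[mu]_(t in I) (w r t `^ p)%:E <= (2 * M * (1 - r) `^ p)%:E)%E.
Proof.
move=> /andP[r0 r1]; apply/lee_addgt0Pr => e e0.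
have [rho rho01 hrho] := mean_defect_powR_small ha XS p0 p1 e0.
pose s := Num.max rho ((1 + r) / 2).
have s1 : s < 1 by rewrite gt_max; have /andP[_ ->] := rho01 => /=; lra.
have rs : r < s by rewrite lt_max; apply/orP; right; lra.
have s0 : 0 < s by apply: lt_trans rs.
have hs := hrho s; have {hs} hs : (\int[mu]_(t in I) (w s t `^ p)%:E <= e%:E)%E.
  by apply: hs; rewrite s1 andbT le_max lexx.
pose clip u := Num.max 0 (Num.min u s).
pose K u t := 2 * p * (cmod (dB (circ (clip u) t)) `^ p * (1 - clip u) `^ (p - 1)).
have K0 u t : 0 <= K u t by rewrite !mulr_ge0 ?powR_ge0 ?(ltW p0).
have mK : measurable_fun setT (fun st : R * R => K st.1 st.2).
  apply: measurable_funM => //.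
  by apply: measurable_dblaschke_weight; rewrite (ltW s0).
have clipE u : u \in `[r, s] -> clip u = u.
  rewrite in_itv/= => /andP[ru us].
  by rewrite /clip min_l// max_r// (le_trans (ltW r0)).
have mIK : measurable_fun setT (fun t => \int[mu]_(u in `[r, s]) (K u t)%:E)%E.
  exact: measurable_integral_rectangle.
have rr : 0 <= r < 1 by rewrite (ltW r0).
have ss : 0 <= s < 1 by rewrite (ltW s0).
apply: (@le_trans _ _ (\int[mu]_(t in I) ((w s t `^ p)%:E +
    \int[mu]_(u in `[r, s]) (K u t)%:E))%E).
  apply: ge0_le_integral => //.
  - by move=> t _; rewrite lee_fin powR_ge0.
  - apply/measurable_EFinP; apply: measurable_funTS.
    exact: (measurableT_comp (measurable_powR _) (measurable_defect ha XS rr)).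
  - apply: emeasurable_funD; last exact: measurable_funTS.
    apply/measurable_EFinP; apply: measurable_funTS.
    exact: (measurableT_comp (measurable_powR _) (measurable_defect ha XS ss)).
  - move=> t _; rewrite -leeBlDl//.
    apply: (le_trans (defect_powR_decay blaschke_taylor (cmod_blaschke_lt1 ha XS)
      (schwarz_pick_blaschke ha XS) dB_cont p0 p1 t (ltW r0) rs s1)).
    rewrite le_eqVlt; apply/orP; left; apply/eqP; apply: eq_integral => u.
    by rewrite inE/= => /clipE uE; rewrite /K uE.
rewrite ge0_integralD//; last 4 first.
- by move=> t _; rewrite lee_fin powR_ge0.
- apply/measurable_EFinP; apply: measurable_funTS.
  exact: (measurableT_comp (measurable_powR _) (measurable_defect ha XS ss)).
- by move=> t _; apply: integral_ge0 => u _; rewrite lee_fin.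
- exact: measurable_funTS.
rewrite addeC; apply: leeD => //.
rewrite tonelli_rectangle//.
apply: (@le_trans _ _ (\int[mu]_(u in `[r, s])
    ((2 * p * M)%:E * ((1 - u) `^ (p - 1))%:E))%E).
  apply: ge0_le_integral; first exact: measurable_itv.
  - by move=> u _; apply: integral_ge0 => t _; rewrite lee_fin.
  - apply: measurable_funTS.
    apply: (@measurable_integral_rectangle _ (fun t u => K u t)) => //.
    exact: measurableT_comp mK (measurable_fun_pair measurable_snd measurable_fst).
  - apply/measurable_EFinP; apply: measurable_funTS.
    apply: measurable_funM => //; apply: (measurableT_comp (measurable_powR _)).
    exact: measurable_funB.
  - move=> u uI; have uE := clipE u uI.
    move: uI; rewrite /= in_itv/= => /andP[ru us].
    have u0 : 0 < u := lt_le_trans r0 ru.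
    have u1 : u < 1 := le_lt_trans us s1.
    have c0 : 0 <= 2 * p * (1 - u) `^ (p - 1) by rewrite !mulr_ge0 ?powR_ge0 ?(ltW p0).
    have -> : (fun t => (K u t)%:E) =
        (fun t => (2 * p * (1 - u) `^ (p - 1))%:E * (cmod (dB (circ u t)) `^ p)%:E)%E.
      by apply/funext => t; rewrite /K uE -EFinM; congr (_%:E); ring.
    rewrite ge0_integralZl_EFin//; last 2 first.
    + by move=> t _; rewrite lee_fin powR_ge0.
    + apply/measurable_EFinP; apply: measurable_funTS.
      apply: (measurableT_comp (measurable_powR _)); apply: cmeasurable_cmod.
      apply: (cmeasurable_dblaschke ha XS); first exact: cmeasurable_circ.
      by move=> t; rewrite cmod_circ ger0_norm// ltW.
    apply: (@le_trans _ _ ((2 * p * (1 - u) `^ (p - 1))%:E * M%:E)%E).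
      by apply: lee_wpmul2l; [rewrite lee_fin | apply: dB_hardy; rewrite u0].
    by rewrite -!EFinM lee_fin le_eqVlt; apply/orP; left; apply/eqP; ring.
rewrite ge0_integralZl_EFin//; last 3 first.
- by move=> u _; rewrite lee_fin powR_ge0.
- apply/measurable_EFinP; apply: measurable_funTS.
  by apply: (measurableT_comp (measurable_powR _)); exact: measurable_funB.
- by rewrite !mulr_ge0// ltW.
rewrite integral_powR_weight// -EFinM lee_fin.
rewrite (_ : 2 * p * M * _ = 2 * M * ((1 - r) `^ p - (1 - s) `^ p)); last first.
  by field; exact: lt0r_neq0.
by rewrite ler_wpM2l ?mulr_ge0// gerBl powR_ge0.
Qed.

End Decay.

(** * Geometric separation, and arcs under the zeros *)

Section SeparatedSum.
Context {R : realType}.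

(** Numbers that grow geometrically when listed in increasing order have their
    sum of (-p)-th powers controlled by the smallest one; peeling off that one
    multiplies the lower bound [h] by [q]. *)
Lemma separated_sum_powRN (p q : R) (x : nat -> R) (s : seq nat) (h : R) :
  0 < p -> 1 < q -> uniq s -> 0 < h -> (forall n, n \in s -> h <= x n) ->
  (forall n m, n \in s -> m \in s -> n <> m -> x n <= x m -> q * x n <= x m) ->
  \sum_(n <- s) x n `^ (- p) <= (1 - q `^ (- p))^-1 * h `^ (- p).
Proof.
move=> p0 q1; have q0 : 0 < q by rewrite (lt_trans ltr01).
have qp1 : q `^ (- p) < 1.
  rewrite powRN invf_lt1 ?powR_gt0//.
  have <- : 1 `^ p = 1 :> R by rewrite powR1.
  by apply: gt0_ltr_powR; rewrite ?nnegrE ?(ltW q0) ?ler01.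
set K := (1 - q `^ (- p))^-1.
have K0 : 0 < K by rewrite invr_gt0 subr_gt0.
have KE : 1 + K * q `^ (- p) = K.
  by rewrite /K; field; rewrite subr_eq0 gt_eqF.
move En : (size s) => n; elim: n s h En => [|n IH] s h En us h0 hs sep.
  by move/size0nil: En => ->; rewrite big_nil mulr_ge0 ?powR_ge0// ltW.
have [k ks kmin] : exists2 k, k \in s & forall m, m \in s -> x k <= x m.
  clear -En; elim: s n En => // m s IH n _.
  have [->|s0] := eqVneq s [::].
    by exists m; rewrite ?inE// => j; rewrite inE => /eqP ->.
  have [|k ks hk] := IH (size s).-1.
    by rewrite prednK// lt0n size_eq0.
  have [km|mk] := leP (x k) (x m).
    by exists k; [rewrite inE ks orbT | move=> j; rewrite inE => /predU1P[->|/hk]].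
  exists m; first by rewrite inE eqxx.
  by move=> j; rewrite inE => /predU1P[->//|/hk]; exact: le_trans (ltW mk).
have xk0 : 0 < x k := lt_le_trans h0 (hs k ks).
have hrem j : j \in rem k s -> j \in s /\ j <> k.
  by rewrite mem_rem_uniq// inE => /andP[/eqP].
rewrite (perm_big _ (perm_to_rem ks)) big_cons/=.
have IHs : \sum_(j <- rem k s) x j `^ (- p) <= K * (q * x k) `^ (- p).
  apply: IH.
  - by rewrite size_rem// En.
  - exact: rem_uniq.
  - by rewrite mulr_gt0.
  - by move=> j /hrem[js jk]; apply: sep => //; [exact/nesym | exact: kmin].
  - by move=> i j /hrem[si _] /hrem[sj _]; exact: sep.
apply: (le_trans (lerD (lexx _) IHs)).
rewrite powRM ?(ltW q0) ?(ltW xk0)//.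
rewrite (_ : _ + _ = (1 + K * q `^ (- p)) * x k `^ (- p)); last by ring.
rewrite KE ler_wpM2l ?(ltW K0)//; apply: powRN_antitone => //; exact: hs.
Qed.

End SeparatedSum.

Section Arcs.
Context {R : realType}.

Lemma lipschitz1_derive (f df : R -> R) (u v : R) :
  (forall x : R, is_derive x (1 : R) f (df x)) -> (forall x, `|df x| <= 1) ->
  `|f u - f v| <= `|u - v|.
Proof.
move=> hd h1; wlog uv : u v / v <= u.
  move=> H; have [|/ltW] := leP v u; first exact: H.
  by rewrite distrC (distrC u); exact: H.
have [|c _ ->] := MVT_segment uv (fun x _ => hd x).
  by apply: within_continuous_itv => x _; exact: is_derive1_continuous.
by rewrite normrM ler_piMl.
Qed.

Lemma polar (z : R[i]) : 0 < cmod z ->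
  exists2 theta : R, 0 <= theta <= 2 * pi & z = circ (cmod z) theta.
Proof.
move=> z0; set r := cmod z; set u := complex.Re z; set v := complex.Im z.
have rE : u ^+ 2 + v ^+ 2 = r ^+ 2 by rewrite -cmod_sq.
have rn : r != 0 by rewrite gt_eqF.
have ur : -1 <= u / r <= 1.
  rewrite -ler_norml normrM normfV (ger0_norm (ltW z0)) ler_pdivrMr// mul1r.
  exact: ler_Re_cmod.
have := acos_ge0 ur; have := acos_lepi ur.
set th := acos (u / r) => thpi th0.
have pi0 := @pi_gt0 R.
have cth : cos th = u / r by rewrite /th acosK.
have sth : sin th = `|v| / r.
  rewrite /th sin_acos// (_ : 1 - _ = (v / r) ^+ 2).
    by rewrite sqrtr_sqr normrM normfV (ger0_norm (ltW z0)).
  rewrite !exprMn exprVn (_ : v ^+ 2 = r ^+ 2 - u ^+ 2); first by field.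
  by rewrite -rE; ring.
have zE : z = u +i* v by rewrite /u /v; case: (z).
have [v0|v0] := leP 0 v.
  exists th; first by rewrite th0/=; lra.
  rewrite /circ cth sth ger0_norm// {1}zE; apply/eqP; rewrite eq_complex/=.
  by apply/andP; split; apply/eqP; field.
exists (2 * pi - th); first by apply/andP; split; lra.
have -> : 2 * pi - th = - th + pi *+ 2 by rewrite mulr_natl addrC.
rewrite /circ cosD2pi sinD2pi cosN sinN cth sth ltr0_norm// {1}zE.
by apply/eqP; rewrite eq_complex/=; apply/andP; split; apply/eqP; field.
Qed.

(** The arc runs away from the nearer end of [0, 2 pi], so that it does not
    leave that interval. *)
Lemma circle_arc (z : R[i]) (l : R) : 0 < cmod z < 1 -> 0 < l <= 1 ->
  exists al : R, [/\ 0 <= al, al + l <= 2 * pi &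
    forall t, al <= t <= al + l -> cmod (circ (cmod z) t - z) <= 2 * l].
Proof.
move=> /andP[z0 z1] /andP[l0 l1]; have [th /andP[th0 th2] zE] := polar z0.
have pi2 := @pi_ge2 R.
have near t : `|t - th| <= l -> cmod (circ (cmod z) t - z) <= 2 * l.
  move=> tth; rewrite {2}zE /circ -mulrBr cmodM cmodC (ger0_norm (ltW z0)).
  apply: le_trans (_ : 1 * (l + l) <= _); last by lra.
  apply: ler_pM; rewrite ?cmod_ge0 ?(ltW z0) ?(ltW z1)//.
  apply: (le_trans (ler_cmod_ReIm _)) => /=; apply: lerD; apply: le_trans tth.
    apply: (@lipschitz1_derive cos (fun y => - sin y)) => // y.
    by rewrite normrN ler_norml sin_geN1 sin_le1.
  apply: (@lipschitz1_derive sin cos) => // y.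
  by rewrite ler_norml cos_geN1 cos_le1.
have [thpi|thpi] := leP th pi.
  exists th; split => //; first by lra.
  by move=> t /andP[h1 h2]; apply: near; rewrite ler_norml; lra.
exists (th - l); split; [lra | lra |].
by move=> t /andP[h1 h2]; apply: near; rewrite ler_norml; lra.
Qed.

End Arcs.

(** * Counting the zeros *)

Section Counting.
Context {R : realType} (a : nat -> R[i]).
Hypothesis ha : forall n, 0 < cmod (a n) < 1.
Local Notation x := (fun k => 1 - cmod (a k)).
Variable S : R.
Hypothesis XS : \sum_(0 <= k < n) x k @[n --> \oo] --> S.
Local Notation mu := (@lebesgue_measure R).
Local Notation I := (`[0%R, (2 * pi)%R]%classic : set R).
Local Notation B := (blaschke_product a).
Local Notation dB := (derive1 (blaschke_product a)).
Local Notation w := (defect B).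
Variables (p M : R).
Hypotheses (p0 : 0 < p) (p1 : p < 1) (M0 : 0 <= M).
Hypothesis dB_cont : forall z, cmod z < 1 -> forall e : R, 0 < e ->
  exists2 d : R, 0 < d & forall u : R[i], cmod (u - z) < d -> cmod (dB u - dB z) < e.
Hypothesis dB_hardy : forall r, 0 < r < 1 ->
  (\int[mu]_(t in I) (cmod (dB (circ r t)) `^ p)%:E <= M%:E)%E.
Variable delta : R.
Hypotheses (delta0 : 0 < delta) (delta1 : delta <= 1).
Hypothesis a_disc : forall m n, m <> n -> delta <= pseudohyp (a m) (a n).

(* [c * (1 - |a_n|)] is the length of the arc under [a_n]. The points of that arc
   at radius |a_n| are at distance at most 2 c (1 - |a_n|) from [a_n]; the value
   delta / 8 makes two such errors at most half of the separation. *)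
Let c := delta / 8.
Let c0 : 0 < c. Proof. by rewrite divr_gt0. Qed.
Let x_gt0 n : 0 < x n. Proof. by rewrite subr_gt0; case/andP: (ha n). Qed.
Let x_lt1 n : x n < 1. Proof. by rewrite gtrBl; case/andP: (ha n). Qed.

Let near_zero n t := cmod (circ (cmod (a n)) t - a n) <= 2 * (c * x n).

(** Below [a_n] the product has modulus at most 1/4, because the factor with zero
    [a_n] has. By monotonicity along the radius, 1 - |a_n| is then bounded below
    in terms of any outer radius [r]. *)
Lemma defect_near_zero n t (r : R) : near_zero n t -> cmod (a n) <= r -> r < 1 ->
  3 / 8 * (1 - r) / w r t <= x n.
Proof.
move=> nz ar r1; have /andP[an0 an1] := ha n.
set s := cmod (a n) in an0 an1 ar.
have r0 : 0 < r := lt_le_trans an0 ar.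
have cs : cmod (circ s t) < 1 by rewrite cmod_circ ger0_norm// ltW.
have Bs : cmod (B (circ s t)) <= 4^-1.
  apply: (le_trans (cmod_blaschke_le ha XS n cs)).
  have := moebius_den_neq0 (ha n) cs; rewrite -cmod_gt0 => dn0.
  rewrite cmod_factor// ler_pdivrMr// cmodB; apply: (le_trans nz).
  have := ler_moebius_den2 (a n) (ltW cs).
  have := mulr_ge0 (ltW c0) (ltW (x_gt0 n)).
  move: (x_gt0 n) => /= xn0 h0 h1.
  have : c * (1 - cmod (a n)) <= 8^-1 * (1 - cmod (a n)).
    by rewrite ler_wpM2r ?(ltW xn0)// /c ler_pdivrMr// mulVf.
  lra.
have ws : 3 / 4 <= w s t.
  have : cmod (B (circ s t)) ^+ 2 <= 4^-1 * 1.
    by rewrite expr2; apply: ler_pM; rewrite ?cmod_ge0//; lra.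
  by rewrite /defect; lra.
have gr := defect_growth (blaschke_taylor ha XS) (cmod_blaschke_lt1 ha XS)
      (schwarz_pick_blaschke ha XS) t (ltW an0) ar r1.
have wr0 : 0 < w r t.
  by apply: (defect_gt0 (cmod_blaschke_lt1 ha XS)); rewrite ger0_norm// ltW.
have ds : 0 < 1 - s by rewrite subr_gt0.
have dr : 0 < 1 - r by rewrite subr_gt0.
rewrite ler_pdivrMr// mulrC.
rewrite -/s.
have h1 : 3 / 4 * (1 - s)^-1 <= w s t * ((1 + s) / (1 - s)).
  rewrite mulrA ler_wpM2r ?invr_ge0 ?(ltW ds)//.
  have : w s t * 1 <= w s t * (1 + s).
    apply: ler_wpM2l; last by rewrite lerDl ltW.
    by apply: le_trans ws; rewrite divr_ge0.
  by rewrite mulr1; exact: le_trans ws.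
have h2 : w r t * ((1 + r) / (1 - r)) <= w r t * (2 / (1 - r)).
  apply: ler_wpM2l; first exact: ltW.
  by apply: ler_wpM2r; [rewrite invr_ge0 ltW | lra].
have := le_trans h1 (le_trans gr h2).
rewrite ler_pdivrMr// !mulrA mulrAC ler_pdivlMr//; lra.
Qed.

(** Two zeros over the same direction have nearly the same argument, so their
    pseudohyperbolic separation must come from their moduli. *)
Lemma near_zero_separated m n t : m <> n -> near_zero m t -> near_zero n t ->
  x m <= x n -> (1 - delta / 2)^-1 * x m <= x n.
Proof.
move=> mn hm hn xmn.
have d2 : 0 < 1 - delta / 2 by move: delta1; lra.
rewrite mulrC ler_pdivrMr//.
have /andP[am0 am1] := ha m; have /andP[an0 an1] := ha n.
have := a_disc mn; rewrite /pseudohyp cmodM cmodV.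
have dn0 := moebius_den_neq0 (ha n) am1; rewrite -cmod_gt0 in dn0.
rewrite ler_pdivlMr// => h.
have h2 := ler_moebius_den2 (a n) (ltW am1).
have h3 : delta * x n <= cmod (a m - a n).
  by apply: le_trans h; rewrite ler_wpM2l// ltW.
have h4 : cmod (a m - a n) <= 2 * (c * x m) + (x n - x m) + 2 * (c * x n).
  rewrite (_ : a m - a n = - (circ (cmod (a m)) t - a m) +
    (circ (cmod (a m) - cmod (a n)) t + (circ (cmod (a n)) t - a n))); last first.
    by rewrite circD (_ : circ (- cmod (a n)) t = - circ (cmod (a n)) t);
      [ring | rewrite /circ rmorphN mulNr].
  apply: (le_trans (ler_cmodD _ _)); rewrite cmodN -addrA; apply: lerD => //.
  apply: (le_trans (ler_cmodD _ _)); apply: lerD => //.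
  rewrite cmod_circ ger0_norm; first by lra.
  by move: xmn => /=; lra.
have h5 : c * x m <= c * x n by rewrite ler_wpM2l// ltW.
have : 8 * c = delta by rewrite /c mulrC divfK.
move: h3 h4 h5 => /=; move: (cmod _) => D; nra.
Qed.

Let ratio_gt1 : 1 < (1 - delta / 2)^-1.
Proof.
rewrite invf_gt1; first by move: delta0; lra.
by move: delta1; lra.
Qed.

Let K := (1 - ((1 - delta / 2)^-1) `^ (- p))^-1.

(** Fix a direction [t] and look at the zeros whose arc contains it: their
    distances to the circle are geometrically separated, and none is much
    smaller than (1 - r) / w r t. *)
Lemma near_zero_sum_le (t r : R) (s : seq nat) : 0 < r < 1 -> uniq s ->
  (forall n, n \in s -> near_zero n t /\ cmod (a n) <= r) ->
  \sum_(n <- s) x n `^ (- p) <= K * ((3 / 8) `^ (- p) * (1 - r) `^ (- p)) * w r t `^ p.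
Proof.
move=> /andP[r0 r1] us hs.
have wr0 : 0 < w r t.
  by apply: (defect_gt0 (cmod_blaschke_lt1 ha XS)); rewrite ger0_norm// ltW.
have dr : 0 < 1 - r by rewrite subr_gt0.
have h0 : 0 < 3 / 8 * (1 - r) / w r t by rewrite divr_gt0// mulr_gt0.
have := separated_sum_powRN p0 ratio_gt1 us h0 (x := x).
rewrite -/K => /(_ _ _)/le_trans; apply.
- by move=> n /hs[nz ar]; exact: defect_near_zero.
- by move=> m n /hs[nm _] /hs[nn _] mn; exact: near_zero_separated nm nn.
- rewrite powRM ?mulr_ge0 ?(ltW dr) ?invr_ge0 ?(ltW wr0)//.
  rewrite (powRM _ _ (ltW dr))//.
  rewrite -(powR_inv1 (ltW wr0)) -powRrM mulN1r opprK.
  by rewrite !mulrA.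
Qed.

(** As the arc under [a_n] has length c x_n, the sum of the c x_n^(1-p) is the
    integral over directions of the sum of the x_n^(-p) over the arcs that
    contain [t]. The powers of 1 - r cancel, so the bound does not depend on the
    radius [r] chosen to enclose the first [N] zeros. *)
Lemma partial_sum_le (N : nat) :
  \sum_(0 <= n < N) x n `^ (1 - p) <= K * (3 / 8) `^ (- p) * (2 * M) / c.
Proof.
have [r r01 hr] : exists2 r : R, 0 < r < 1 & forall n, (n < N)%N -> cmod (a n) <= r.
  elim: N => [|N [r /andP[r0 r1] hr]]; first by exists 2^-1 => //; lra.
  have /andP[aN0 aN1] := ha N.
  exists (Num.max r (cmod (a N))).
    by rewrite lt_max r0/= gt_max r1.
  move=> n; rewrite ltnS leq_eqVlt => /predU1P[->|/hr]; rewrite le_max ?lexx ?orbT//.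
  by move=> ->.
have /andP[r0 r1] := r01; have dr : 0 < 1 - r by rewrite subr_gt0.
have l01 n : 0 < c * x n <= 1.
  rewrite mulr_gt0//= mulr_ile1 ?(ltW c0) ?(ltW (x_gt0 n)) ?(ltW (x_lt1 n))//.
  by rewrite /c; move: delta1; lra.
have [al hal] := choice (fun n => circle_arc (ha n) (l01 n)).
pose J n : set R := `[al n, al n + c * x n]%classic.
have mJ n : measurable (J n) by exact: measurable_itv.
have JI n : J n `<=` I.
  move=> t; have [h1 h2 _] := hal n; rewrite /J /= !in_itv/= => /andP[h3 h4].
  by rewrite (le_trans h1 h3) (le_trans h4 h2).
have muJ n : mu (J n) = (c * x n)%:E.
  rewrite /J lebesgue_measure_itv/= lte_fin ltrDl mulr_gt0 ?x_gt0//.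
  by rewrite -EFinB addrAC subrr add0r.
pose f n t : R := x n `^ (- p) * \1_(J n) t.
have mf n : measurable_fun setT (f n).
  by apply: measurable_funM => //; exact: measurable_indic.
have intf n : (\int[mu]_(t in I) (f n t)%:E = (c * x n `^ (1 - p))%:E)%E.
  have -> : (fun t => (f n t)%:E) = (fun t => (x n `^ (- p))%:E * (\1_(J n) t)%:E)%E.
    by apply/funext => t; rewrite -EFinM.
  rewrite ge0_integralZl_EFin ?powR_ge0//; last first.
    apply/measurable_EFinP; apply: measurable_funTS. exact: (measurable_indic (mJ n)).
  rewrite integral_indic//; last exact: mJ.
  rewrite (_ : _ `&` _ = J n); last exact: setIidl (JI n).
  rewrite [X in (_ * X)%E](_ : _ = (c * x n)%:E); last exact: muJ.
  rewrite -EFinM; congr (_%:E).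
  rewrite powRD; last by rewrite (gt_eqF (x_gt0 n)) implybT.
  by rewrite powRr1 ?(ltW (x_gt0 n))//; ring.
set C := K * (3 / 8) `^ (- p).
have K0 : 0 <= K.
  have q0 : 0 < (1 - delta / 2)^-1 := lt_trans ltr01 ratio_gt1.
  rewrite invr_ge0 subr_ge0 powRN invf_le1 ?powR_gt0//.
  rewrite -[leLHS](_ : 1 `^ p = 1); last by rewrite powR1.
  by apply: ge0_ler_powR; rewrite ?nnegrE ?(ltW p0) ?ler01 ?(ltW q0) ?(ltW ratio_gt1).
have C0 : 0 <= C by rewrite mulr_ge0 ?powR_ge0.
rewrite ler_pdivlMr//.
have -> : (\sum_(0 <= n < N) x n `^ (1 - p)) * c = \sum_(0 <= n < N) (c * x n `^ (1 - p)).
  by rewrite mulr_suml; apply: eq_bigr => n _; rewrite mulrC.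
rewrite -lee_fin -sumEFin.
under eq_bigr do rewrite -intf.
rewrite -ge0_integral_sum//; last 2 first.
- by move=> n; apply/measurable_EFinP; apply: measurable_funTS; exact: mf.
- by move=> n t _; rewrite lee_fin mulr_ge0 ?powR_ge0.
have rr : 0 <= r < 1 by rewrite (ltW r0).
have mw : measurable_fun setT (fun t => w r t `^ p).
  exact: (measurableT_comp (measurable_powR _) (measurable_defect ha XS rr)).
apply: (@le_trans _ _ (\int[mu]_(t in I)
    ((C * (1 - r) `^ (- p))%:E * (w r t `^ p)%:E))%E).
  apply: ge0_le_integral => //.
  - by move=> t _; apply: sume_ge0 => n _; rewrite lee_fin mulr_ge0 ?powR_ge0.
  - apply: emeasurable_sum => n.
    by apply/measurable_EFinP; apply: measurable_funTS; exact: mf.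
  - apply/measurable_EFinP; apply: measurable_funTS.
    by apply: measurable_funM.
  - move=> t _; rewrite sumEFin -EFinM lee_fin.
    pose s := [seq n <- index_iota 0 N | t \in J n].
    have -> : \sum_(0 <= n < N) f n t = \sum_(n <- s) x n `^ (- p).
      rewrite [RHS]big_filter [RHS]big_mkcond; apply: eq_bigr => n _.
      by rewrite /f indicE; case: (t \in J n); rewrite ?mulr1 ?mulr0.
    rewrite /C -(mulrA K); apply: near_zero_sum_le => //.
      exact/filter_uniq/iota_uniq.
    move=> n; rewrite mem_filter mem_index_iota => /and3P[tJ _ nN]; split; last exact: hr.
    have [_ _] := hal n; apply.
    by move: tJ; rewrite inE /J/= in_itv.
rewrite ge0_integralZl_EFin ?mulr_ge0 ?powR_ge0//; last 2 first.
- by move=> t _; rewrite lee_fin powR_ge0.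
- by apply/measurable_EFinP; exact: measurable_funTS.
apply: (@le_trans _ _ ((C * (1 - r) `^ (- p))%:E * (2 * M * (1 - r) `^ p)%:E)%E).
  apply: lee_wpmul2l; first by rewrite lee_fin mulr_ge0 ?powR_ge0.
  exact: (mean_defect_powR_decay ha XS p0 p1 M0 dB_cont dB_hardy r01).
rewrite -EFinM lee_fin powRN le_eqVlt; apply/orP; left; apply/eqP; field.
by rewrite gt_eqF// powR_gt0.
Qed.

End Counting.

Theorem theorem3 (R : realType) (p : R) (hp0 : 0 < p) (hp1 : p < 1)
    (a : nat -> complex R) (ha : blaschke_sequence a)
    (hdisc : uniformly_discrete a)
    (hB' : hardy p (derive1 (blaschke_product a))) :
  (\sum_(0 <= n <oo) ((1 - cmod (a n)) `^ (1 - p))%:E < +oo)%E.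
Proof.
have [a01 asum] := ha; have [delta delta0 hdelta] := hdisc.
have x0 n : 0 <= 1 - cmod (a n) by exact: bdist_ge0.
have cX : cvgn (fun n => \sum_(0 <= k < n) (1 - cmod (a k))).
  apply: nondecreasing_is_cvgn.
    by apply/nondecreasing_seqP => n; rewrite big_nat_recr//= lerDl.
  move: asum; set s := (X in (X < _)%E) => asum.
  have s0 : (0 <= s)%E by apply: nneseries_ge0 => n _ _; rewrite lee_fin.
  have sE : s = (fine s)%:E by rewrite fineK// ge0_fin_numE.
  exists (fine s) => _ [n _ <-]; rewrite -lee_fin -sE -sumEFin.
  by apply: nneseries_lim_ge => k _ _; rewrite lee_fin.
have [M M0 hM] := hardy_bound hp0 hB'.
have dcont z : cmod z < 1 -> forall e : R, 0 < e ->
    exists2 d : R, 0 < d & forall u : R[i], cmod (u - z) < d ->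
    cmod (derive1 (blaschke_product a) u - derive1 (blaschke_product a) z) < e.
  by move=> hz; apply: derivable_cmod_continuous; exact: hB'.1.
have d0 : 0 < Num.min delta 1 by rewrite lt_min delta0 ltr01.
have d1 : Num.min delta 1 <= 1 by rewrite ge_min lexx orbT.
have hd m n : m <> n -> Num.min delta 1 <= pseudohyp (a m) (a n).
  by move=> mn; rewrite ge_min hdelta.
have [C bound] : exists C, forall N,
    \sum_(0 <= n < N) (1 - cmod (a n)) `^ (1 - p) <= C.
  by eexists=> N; exact: (partial_sum_le a01 cX hp0 hp1 M0 dcont hM d0 d1 hd).
apply: (@le_lt_trans _ _ C%:E); last exact: ltry.
apply: lime_le; first by apply: is_cvg_nneseries => n _ _; rewrite lee_fin powR_ge0.
by near=> n; rewrite sumEFin lee_fin; exact: bound.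
Unshelve. all: by end_near. Qed.
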